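(* Let $S$ be a semisimple Lie subalgebra of $\mathfrak{sl}(\mathfrak{m})$, where $\mathfrak{m}$ is a vector space of dimension $d$ regarded as the natural module through the representation $\rho=\mathrm{id}$. Then the extended module structure on $\mathcal{N}(\mathfrak{m},2)=\mathfrak{m}\oplus\bigwedge^2\mathfrak{m}$ and $\mathcal{N}(\mathfrak{m},3)=\mathfrak{m}\oplus\bigwedge^2\mathfrak{m}\oplus\mathfrak{s}$ is given by considering $\bigwedge^2\mathfrak{m}$ and $\mathfrak{s}$ as the $S$-submodules provided by the natural action of $S$ on $\mathfrak{m}\otimes\mathfrak{m}$ and $\mathfrak{m}\otimes\bigwedge^2\mathfrak{m}$ respectively. Moreover: (a) The $2$-nilpotent algebras (also known as metabelian) of type $\dim\mathfrak{m}$ that admit $S$ as faithful Levi extension are of the form $\mathcal{N}(\mathfrak{m},2)/I$, where $I$ is an $S$-submodule of $\bigwedge^2\mathfrak{m}$ other than $\bigwedge^2\mathfrak{m}$. (b) The $3$-nilpotent algebras of type $\dim\mathfrak{m}$ that admit $S$ as faithful Levi extension are of the form $$\frac{\mathcal{N}(\mathfrak{m},3)}{J+[J,\mathfrak{m}]},$$ where $J$ is an $S$-submodule of $\bigwedge^2\mathfrak{m}\oplus\mathfrak{s}$ such that $\mathfrak{s}\not\subseteq J+[J,\mathfrak{m}]$.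
   Context: All vector spaces and algebras are finite-dimensional over a field $k$ of characteristic zero. For a Lie algebra $N$: $N^1=N$, $N^{j+1}=[N,N^j]$; $N$ is $t$-nilpotent if $N^t\neq0$ and $N^{t+1}=0$; the type of $N$ is $\dim N/N^2$. A semisimple Lie algebra $S$ is a Levi extension of a solvable Lie algebra $R$ if there is a representation $\sigma:S\to\mathfrak{gl}(R)$ with $\sigma(S)\subseteq\mathrm{Der}\,R$, the derivation algebra of $R$; the Levi extension is faithful if $\sigma$ is faithful. $\mathcal{N}(\mathfrak{m},2)=\mathfrak{m}\oplus\bigwedge^2\mathfrak{m}$ is the Lie algebra with $[x,y]=x\wedge y$ for $x,y\in\mathfrak{m}$ and all other products zero; it is a model of the free $2$-nilpotent Lie algebra generated by $\mathfrak{m}$. Let $\mathfrak{s}=\mathrm{span}\langle 2x\otimes(y\wedge z)+y\otimes(x\wedge z)+z\otimes(y\wedge x): x,y,z\in\mathfrak{m}\rangle\subseteq\mathfrak{m}\otimes\bigwedge^2\mathfrak{m}$. $\mathcal{N}(\mathfrak{m},3)=\mathfrak{m}\oplus\bigwedge^2\mathfrak{m}\oplus\mathfrak{s}$ is the Lie algebra with skew-symmetric product given, for $x,y,z\in\mathfrak{m}$, by $[x,y]=x\wedge y$ and $$[x,y\wedge z]=\tfrac23\,x\otimes(y\wedge z)+\tfrac13\,y\otimes(x\wedge z)+\tfrac13\,z\otimes(y\wedge x),$$ all other products being zero; it is a model of the free $3$-nilpotent Lie algebra generated by $\mathfrak{m}$. Extended module structure: for $i=2,3$, each $\delta\in\mathfrak{gl}(\mathfrak{m})$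 extends uniquely to a derivation $\widehat\delta$ of $\mathcal{N}(\mathfrak{m},i)$, and $S$ acts on $\mathcal{N}(\mathfrak{m},i)$ by $\delta\mapsto\widehat\delta$. The natural action of $\delta\in S$ on tensor powers is $x\otimes y\mapsto\delta(x)\otimes y+x\otimes\delta(y)$ and $x\otimes y\otimes z\mapsto\delta(x)\otimes y\otimes z+x\otimes\delta(y)\otimes z+x\otimes y\otimes\delta(z)$. For a subspace $J$, $[J,\mathfrak{m}]$ denotes the linear span of all $[a,b]$ with $a\in J$, $b\in\mathfrak{m}$.
   Formalization: In (a) and (b), ''admits S as faithful Levi extension'' is taken to include that N/N² is isomorphic, as an S-module, to the natural module m; for an arbitrary faithful representation the claim fails (e.g. S=sl₂ on m=V(3), N=N(2V(1),2)/3V(0)). *)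

(* Defs.v *)
(* Finite-dimensional vector spaces over k are modelled by [vectType k]. *)
From HB Require Import structures.
From mathcomp Require Import all_boot all_order all_algebra.

Set Implicit Arguments.
Unset Strict Implicit.
Unset Printing Implicit Defensive.

Import GRing.Theory.
Local Open Scope ring_scope.

Section BilinearSpan.

Variables (k : fieldType) (V1 V2 W : vectType k) (B : V1 -> V2 -> W).

(* As for [prodv] of MathComp: linear span of the B u v, u in U, v in V,
   computed on bases; [bil_spanP] is its characterization. *)
Definition bil_span (U : {vspace V1}) (V : {vspace V2}) : {vspace W} :=
  <<[seq B u v | u <- vbasis U, v <- vbasis V]>>%VS.

Hypothesis Bl : forall v, linear (B^~ v).
Hypothesis Br : forall u, linear (B u).

Lemma bil_sumr u (I : finType) (a : I -> k) (v : I -> V2) :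
  B u (\sum_i a i *: v i) = \sum_i a i *: B u (v i).
Proof.
have B0 : B u 0 = 0.
  by have := Br u (-1) 0 0; rewrite addr0 !scaleN1r oppr0 addNr.
by elim/big_rec2: _ => // i y1 y2 _ <-; rewrite Br.
Qed.

Lemma bil_suml v (I : finType) (a : I -> k) (u : I -> V1) :
  B (\sum_i a i *: u i) v = \sum_i a i *: B (u i) v.
Proof.
have B0 : B 0 v = 0.
  by have := Bl v (-1) 0 0; rewrite /= addr0 !scaleN1r oppr0 addNr.
by elim/big_rec2: _ => // i y1 y2 _ <-; rewrite [LHS]Bl.
Qed.

Lemma mem_bil_span (U : {vspace V1}) (V : {vspace V2}) u v :
  u \in U -> v \in V -> B u v \in bil_span U V.
Proof.
move=> /coord_vbasis-> /coord_vbasis->.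
rewrite bil_suml; apply: memv_suml => i _; rewrite memvZ//.
rewrite bil_sumr; apply: memv_suml => j _; rewrite memvZ//.
by apply/memv_span/allpairsP; exists ((vbasis U)`_i, (vbasis V)`_j);
  rewrite !memt_nth.
Qed.

Lemma bil_spanP (U : {vspace V1}) (V : {vspace V2}) (X : {vspace W}) :
  reflect {in U & V, forall u v, B u v \in X} (bil_span U V <= X)%VS.
Proof.
apply: (iffP idP) => [sX u v Uu Vv|sX]; first exact/(subvP sX)/mem_bil_span.
apply/span_subvP=> _ /allpairsP[[u v] /= [Uu Vv ->]].
by rewrite sX ?vbasis_mem.
Qed.

End BilinearSpan.

HB.mixin Record Vector_isLie (k : fieldType) L of Vector k L := {
  lie : L -> L -> L;
  lie_linearl : forall y, linear (lie^~ y);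
  lie_linearr : forall x, linear (lie x);
  lie_alt : forall x, lie x x = 0;
  lie_jacobi : forall x y z,
    lie x (lie y z) + lie y (lie z x) + lie z (lie x y) = 0
}.

#[short(type="lieAlgType")]
HB.structure Definition LieAlgebra (k : fieldType) :=
  { L of Vector_isLie k L & Vector k L }.

Section LieTheory.

Variables (k : fieldType) (L : lieAlgType k).
Implicit Types (x y : L) (U V I : {vspace L}).

HB.instance Definition _ x := GRing.isLinear.Build k L L _ (lie x)
  (lie_linearr x).

Lemma lieDl x y z : lie (x + y) z = lie x z + lie y z.
Proof. by have := lie_linearl z 1 x y; rewrite /= !scale1r. Qed.

Lemma lie0l x : lie 0 x = 0.
Proof. by apply: (addrI (lie 0 x)); rewrite -lieDl !addr0. Qed.

Lemma lieC x y : lie x y = - lie y x.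
Proof.
apply/eqP; rewrite -addr_eq0; apply/eqP.
have := lie_alt (x + y).
by rewrite lieDl !linearD /= !lie_alt add0r addr0.
Qed.

(* [U, V] *)
Definition lie_prod U V : {vspace L} := bil_span lie U V.

Lemma mem_lie_prod U V x y : x \in U -> y \in V -> lie x y \in lie_prod U V.
Proof. exact: (mem_bil_span lie_linearl lie_linearr). Qed.

Lemma lie_prodP U V (W : {vspace L}) :
  reflect {in U & V, forall x y, lie x y \in W} (lie_prod U V <= W)%VS.
Proof. exact: (bil_spanP lie_linearl lie_linearr). Qed.

Definition is_subalgebra U := (lie_prod U U <= U)%VS.
Definition is_ideal I := (lie_prod fullv I <= I)%VS.

(* L^j, with L^1 = L and L^(j+1) = [L, L^j]; the value at j = 0 is junk. *)
Definition lower_central (j : nat) : {vspace L} :=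
  iter j.-1 (lie_prod fullv) fullv.

Definition nilpotent (t : nat) : Prop :=
  lower_central t != 0%VS /\ lower_central t.+1 = 0%VS.

(* dim L / L^2 *)
Definition lie_type : nat := (\dim {:L} - \dim (lower_central 2))%N.

Definition solvable_sub U : Prop :=
  exists n, iter n (fun V => lie_prod V V) U = 0%VS.

Definition solvable : Prop := solvable_sub fullv.

(* The radical is zero *)
Definition semisimple : Prop :=
  forall I, is_ideal I -> solvable_sub I -> I = 0%VS.

Definition is_derivation (D : 'End(L)) : Prop :=
  forall x y, D (lie x y) = lie (D x) y + lie x (D y).

End LieTheory.

Arguments lower_central {k} L j.
Arguments nilpotent {k} L t.
Arguments lie_type {k} L.
Arguments solvable {k} L.
Arguments semisimple {k} L.

Section LieMorphism.

Variables (k : fieldType) (L1 L2 : lieAlgType k).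

Definition is_lie_hom (f : 'Hom(L1, L2)) : Prop :=
  forall x y, f (lie x y) = lie (f x) (f y).

Definition lie_isomorphic : Prop :=
  exists f : 'Hom(L1, L2), [/\ is_lie_hom f, lker f = 0%VS & limg f = fullv].

End LieMorphism.

Arguments lie_isomorphic {k} L1 L2.

Section Subalgebra.

Variables (k : fieldType) (L : lieAlgType k).

Record subalgebra := Subalgebra {
  subalg_vs :> {vspace L};
  subalgP : is_subalgebra subalg_vs
}.

Definition sub_lie (S : subalgebra) : Type := subvs_of S.

Variable S : subalgebra.

HB.instance Definition _ := Vector.on (sub_lie S).

Definition sub_bracket (x y : sub_lie S) : sub_lie S :=
  vsproj S (lie (vsval x) (vsval y)).

Lemma vsval_bracket x y : vsval (sub_bracket x y) = lie (vsval x) (vsval y).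
Proof. by rewrite vsprojK// (lie_prodP _ _ _ (subalgP S))// subvsP. Qed.

Lemma sub_linearl y : linear (sub_bracket^~ y).
Proof.
by move=> a u v; apply/val_inj; rewrite /= !vsval_bracket/= [LHS]lie_linearl.
Qed.

Lemma sub_linearr x : linear (sub_bracket x).
Proof.
by move=> a u v; apply/val_inj; rewrite /= !vsval_bracket/= [LHS]lie_linearr.
Qed.

Lemma sub_alt x : sub_bracket x x = 0.
Proof. by apply/val_inj; rewrite /= vsval_bracket lie_alt. Qed.

Lemma sub_jacobi x y z : sub_bracket x (sub_bracket y z) +
  sub_bracket y (sub_bracket z x) + sub_bracket z (sub_bracket x y) = 0.
Proof. by apply/val_inj; rewrite /= !vsval_bracket lie_jacobi. Qed.

HB.instance Definition _ := Vector_isLie.Build k (sub_lie S)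
  sub_linearl sub_linearr sub_alt sub_jacobi.

End Subalgebra.

(* The quotient L / I by an ideal I. The underlying space is the complement
   I^C, onto which L projects along I: [quot_proj] is a surjective Lie
   homomorphism with kernel I. *)
Section Quotient.

Variables (k : fieldType) (L : lieAlgType k).

Record ideal := Ideal {
  ideal_vs :> {vspace L};
  idealP : is_ideal ideal_vs
}.

Definition quot_lie (I : ideal) : Type := subvs_of (I^C)%VS.

Variable I : ideal.

HB.instance Definition _ := Vector.on (quot_lie I).

Definition quot_proj : 'Hom(L, quot_lie I) :=
  linfun (vsproj (I^C)%VS \o daddv_pi (I^C)%VS I).

Definition quot_bracket (x y : quot_lie I) : quot_lie I :=
  quot_proj (lie (vsval x) (vsval y)).

Lemma val_quot_proj x : vsval (quot_proj x) = daddv_pi (I^C)%VS I x.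
Proof. by rewrite lfunE /= vsprojK// memv_pi. Qed.

Let IC0 : (I^C :&: I = 0)%VS.
Proof. by rewrite capvC capv_compl. Qed.

Lemma val_quot_projB x : x - vsval (quot_proj x) \in (I : {vspace L}).
Proof.
rewrite val_quot_proj -[X in X - _](@daddv_pi_add _ _ (I^C)%VS I)//.
  by rewrite addrC addKr memv_pi.
by rewrite addvC addv_complf memvf.
Qed.

Lemma quot_valK (x : quot_lie I) : quot_proj (vsval x) = x.
Proof.
by apply/val_inj; rewrite /= val_quot_proj daddv_pi_id// subvsP.
Qed.

Lemma quot_proj_eq0 x : (quot_proj x == 0) = (x \in (I : {vspace L})).
Proof.
apply/eqP/idP => [p0|Ix].
  by have := val_quot_projB x; rewrite p0 subr0.
apply/val_inj => /=; have := val_quot_projB x.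
rewrite rpredBl// => Ipx; apply/eqP; rewrite -memv0 -IC0 memv_cap Ipx andbT.
exact: subvsP.
Qed.

Lemma lker_quot_proj : lker quot_proj = I.
Proof. by apply/vspaceP => x; rewrite memv_ker quot_proj_eq0. Qed.

Lemma limg_quot_proj : limg quot_proj = fullv.
Proof.
apply/vspaceP => x; rewrite memvf; apply/memv_imgP.
by exists (vsval x); rewrite ?memvf// quot_valK.
Qed.

Lemma quot_projP x y : x - y \in (I : {vspace L}) -> quot_proj x = quot_proj y.
Proof.
by move=> Ixy; apply/eqP; rewrite -subr_eq0 -linearB /= quot_proj_eq0.
Qed.

Lemma quot_proj_lier x y :
  quot_proj (lie x (vsval (quot_proj y))) = quot_proj (lie x y).
Proof.
apply: quot_projP; rewrite -linearB /= (lie_prodP _ _ _ (idealP I)) ?memvf//.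
by rewrite -opprB rpredN val_quot_projB.
Qed.

Lemma quot_proj_liel x y :
  quot_proj (lie (vsval (quot_proj x)) y) = quot_proj (lie x y).
Proof. by rewrite lieC linearN /= quot_proj_lier -linearN /= -lieC. Qed.

Lemma quot_linearl y : linear (quot_bracket^~ y).
Proof.
move=> a u v; rewrite /quot_bracket.
have -> : lie (vsval (a *: u + v)) (vsval y) =
    a *: lie (vsval u) (vsval y) + lie (vsval v) (vsval y).
  exact: (lie_linearl (vsval y) a (vsval u) (vsval v)).
by rewrite linearP.
Qed.

Lemma quot_linearr x : linear (quot_bracket x).
Proof. by move=> a u v; rewrite /quot_bracket /= !linearP. Qed.

Lemma quot_alt x : quot_bracket x x = 0.
Proof. by rewrite /quot_bracket lie_alt linear0. Qed.

Lemma quot_jacobi x y z : quot_bracket x (quot_bracket y z) +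
  quot_bracket y (quot_bracket z x) + quot_bracket z (quot_bracket x y) = 0.
Proof.
by rewrite /quot_bracket !quot_proj_lier -!linearD /= lie_jacobi linear0.
Qed.

HB.instance Definition _ := Vector_isLie.Build k (quot_lie I)
  quot_linearl quot_linearr quot_alt quot_jacobi.

Lemma quot_proj_hom : is_lie_hom quot_proj.
Proof.
by move=> x y; rewrite [RHS]/(quot_bracket _ _) /quot_bracket
  quot_proj_lier quot_proj_liel.
Qed.

End Quotient.

Section GeneralLinear.

Variables (k : fieldType) (V : vectType k).

Definition gl : Type := 'End(V).

HB.instance Definition _ := Vector.on gl.

Definition gl_bracket (f g : gl) : gl := ((f \o g) - (g \o f))%VF.

Lemma gl_linearl g : linear (gl_bracket^~ g).
Proof.
move=> a u v; rewrite /gl_bracket /=.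
rewrite comp_lfunDl comp_lfunDr -comp_lfunZl -comp_lfunZr.
by rewrite scalerBr opprD addrACA.
Qed.

Lemma gl_linearr f : linear (gl_bracket f).
Proof.
move=> a u v; rewrite /gl_bracket /=.
rewrite comp_lfunDl comp_lfunDr -comp_lfunZl -comp_lfunZr.
by rewrite scalerBr opprD addrACA.
Qed.

Lemma gl_alt f : gl_bracket f f = 0.
Proof. exact: subrr. Qed.

Lemma gl_jacobi f g h : gl_bracket f (gl_bracket g h) +
  gl_bracket g (gl_bracket h f) + gl_bracket h (gl_bracket f g) = 0.
Proof.
rewrite /gl_bracket !(comp_lfunDl, comp_lfunDr, comp_lfunNl, comp_lfunNr).
rewrite !comp_lfunA !opprD !opprK !addrA.
rewrite (ACl ((1*11)*(2*8)*(3*5)*(4*10)*(6*12)*(7*9))).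
by rewrite /= !(subrr, addNr, addr0).
Qed.

HB.instance Definition _ := Vector_isLie.Build k gl
  gl_linearl gl_linearr gl_alt gl_jacobi.

(* Trace, read off the matrix in the basis [vbasis fullv] *)
Definition lftrace (f : 'End(V)) : k^o :=
  \tr (passmx.mxof (vbasis {:V}) (vbasis {:V}) f).

Lemma lftrace_is_linear : linear lftrace.
Proof.
by move=> a f g; rewrite /lftrace passmx.mxof_linear mxtraceD mxtraceZ.
Qed.

HB.instance Definition _ := GRing.isLinear.Build k 'End(V) k^o _ lftrace
  lftrace_is_linear.

Definition sl : {vspace gl} := lker (linfun lftrace).

Lemma mem_sl f : (f \in sl) = (lftrace f == 0).
Proof. by rewrite memv_ker lfunE. Qed.

End GeneralLinear.

(* Tensor product of finite-dimensional spaces, modelled by Hom(U^*, V):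
   x (x) y is the map phi |-> phi(x) y. [tensor_univ] is the universal
   property. *)

Section Tensor.

Variables (k : fieldType) (U V : vectType k).

Definition tensor : Type := 'Hom('Hom(U, k^o), V).

HB.instance Definition _ := Vector.on tensor.

Definition tens_fun (x : U) (y : V) (phi : 'Hom(U, k^o)) : V :=
  (phi x : k) *: y.

Lemma tens_fun_linear x y : linear (tens_fun x y).
Proof. by move=> a f g; rewrite /tens_fun !lfun_simp scalerDl scalerA. Qed.

HB.instance Definition _ x y := GRing.isLinear.Build k _ _ _ (tens_fun x y)
  (tens_fun_linear x y).

Fact tens_key : unit. Proof. by []. Qed.
Definition tens_def (x : U) (y : V) : tensor := linfun (tens_fun x y).
Definition tens := locked_with tens_key tens_def.
Canonical tens_unlockable := [unlockable fun tens].

Lemma tensE x y phi : tens x y phi = (phi x : k) *: y.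
Proof. by rewrite [tens]unlock lfunE. Qed.

Lemma tens_linearl y : linear (tens^~ y).
Proof.
move=> a u v; apply/lfunP => phi; rewrite add_lfunE scale_lfunE !tensE.
by rewrite linearP /= scalerDl scalerA.
Qed.

Lemma tens_linearr x : linear (tens x).
Proof.
move=> a u v; apply/lfunP => phi; rewrite add_lfunE scale_lfunE !tensE.
by rewrite scalerDr !scalerA mulrC.
Qed.

HB.instance Definition _ x := GRing.isLinear.Build k V tensor _ (tens x)
  (tens_linearr x).

Let e := vbasis {:U}.

Definition dual_coord (i : 'I_(\dim {:U})) (x : U) : k^o := coord e i x.

Lemma dual_coord_linear i : linear (dual_coord i).
Proof. by move=> a u v; rewrite /dual_coord linearP. Qed.

HB.instance Definition _ i := GRing.isLinear.Build k U k^o _ (dual_coord i)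
  (dual_coord_linear i).

Lemma tens_decomp (t : tensor) :
  t = \sum_(i < \dim {:U}) tens e`_i (t (linfun (dual_coord i))).
Proof.
apply/lfunP => phi; rewrite sum_lfunE.
have {1}-> : phi = \sum_(i < \dim {:U}) (phi e`_i : k) *: linfun (dual_coord i).
  apply/lfunP => x; rewrite sum_lfunE [in LHS](coord_vbasis (memvf x)).
  rewrite linear_sum; apply: eq_bigr => i _.
  by rewrite linearZ /= scale_lfunE lfunE /= [LHS]mulrC.
by rewrite linear_sum; apply: eq_bigr => i _; rewrite linearZ tensE.
Qed.

Lemma tensor_univ (W : vectType k) (B : U -> V -> W) :
  (forall v, linear (B^~ v)) -> (forall u, linear (B u)) ->
  exists! f : 'Hom(tensor, W), forall x y, f (tens x y) = B x y.
Proof.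
move=> Bl Br.
pose F (t : tensor) := \sum_(i < \dim {:U}) B e`_i (t (linfun (dual_coord i))).
have Flin : linear F.
  move=> a s t; rewrite /F scaler_sumr -big_split /=; apply: eq_bigr => i _.
  by rewrite add_lfunE scale_lfunE Br.
pose FL : {linear tensor -> W} :=
  HB.pack F (GRing.isLinear.Build k _ _ _ F Flin).
exists (linfun FL); split=> [x y|g gB].
  rewrite lfunE /= /F [in RHS](coord_vbasis (memvf x)) (bil_suml Bl).
  apply: eq_bigr => i _; rewrite tensE lfunE /=.
  by have := bil_sumr Br e`_i (fun _ : 'I_1 => coord e i x) (fun=> y);
    rewrite !big_ord1.
apply/lfunP => t; rewrite lfunE /= /F [in RHS](tens_decomp t) linear_sum /=.
by apply: eq_bigr => i _; rewrite gB.
Qed.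

(* f (x) 1 + 1 (x) g, see [tens_actE] *)
Definition tens_act_fun (f : 'End(U)) (g : 'End(V)) (t : tensor) : tensor :=
  ((t \o linfun (fun phi : 'Hom(U, k^o) => (phi \o f)%VF)) + (g \o t))%VF.

Lemma tens_act_fun_linear f g : linear (tens_act_fun f g).
Proof.
move=> a s t; rewrite /tens_act_fun comp_lfunDl comp_lfunDr.
by rewrite -comp_lfunZl -comp_lfunZr scalerDr addrACA.
Qed.

HB.instance Definition _ f g := GRing.isLinear.Build k tensor tensor _
  (tens_act_fun f g) (tens_act_fun_linear f g).

Fact tens_act_key : unit. Proof. by []. Qed.
Definition tens_act_def f g : 'End(tensor) := linfun (tens_act_fun f g).
Definition tens_act := locked_with tens_act_key tens_act_def.
Canonical tens_act_unlockable := [unlockable fun tens_act].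

Lemma tens_actE f g x y :
  tens_act f g (tens x y) = tens (f x) y + tens x (g y).
Proof.
apply/lfunP => phi.
rewrite [tens_act]unlock [linfun _ _]lfunE /= /tens_act_fun.
rewrite !add_lfunE !comp_lfunE !tensE.
have pl : linear (fun phi : 'Hom(U, k^o) => (phi \o f)%VF).
  by move=> a u v; rewrite comp_lfunDl -comp_lfunZl.
pose P : {linear _ -> _} := HB.pack (fun phi : 'Hom(U, k^o) => (phi \o f)%VF)
  (GRing.isLinear.Build k _ _ _ _ pl).
by rewrite (lfunE P) /= comp_lfunE linearZ.
Qed.

End Tensor.

(* id (x) f, see [tens_mapE] *)
Section TensorMap.

Variables (k : fieldType) (U V W : vectType k).

Fact tens_map_key : unit. Proof. by []. Qed.
Definition tens_map_def (f : 'Hom(V, W)) (t : tensor U V) : tensor U W :=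
  (f \o t)%VF.
Definition tens_map := locked_with tens_map_key tens_map_def.
Canonical tens_map_unlockable := [unlockable fun tens_map].

Lemma tens_mapE f x y : tens_map f (tens x y) = tens x (f y).
Proof.
apply/lfunP => phi; rewrite [tens_map]unlock /tens_map_def comp_lfunE !tensE.
exact: linearZ.
Qed.

Lemma tens_map_linearl t : linear (tens_map^~ t).
Proof.
move=> a f g; rewrite [tens_map]unlock /tens_map_def /=.
by rewrite comp_lfunDl -comp_lfunZl.
Qed.

Lemma tens_map_linear f : linear (tens_map f).
Proof.
move=> a s t; rewrite [tens_map]unlock /tens_map_def.
by rewrite comp_lfunDr -comp_lfunZr.
Qed.

HB.instance Definition _ f := GRing.isLinear.Build k (tensor U V) (tensor U W) _
  (tens_map f) (tens_map_linear f).

End TensorMap.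

Section Exterior.

Variables (k : fieldType) (m : vectType k).

(* x /\ y as the skew-symmetric tensor x (x) y - y (x) x; the exterior
   square [ext2] is the span of these ([ext2P]). *)
Definition alt (x y : m) : tensor m m := tens x y - tens y x.

Lemma alt_linearl y : linear (alt^~ y).
Proof.
move=> a u v; rewrite /alt [tens _ y](tens_linearl y a u v).
by rewrite [tens y _]tens_linearr scalerBr opprD addrACA.
Qed.

Lemma alt_linearr x : linear (alt x).
Proof.
move=> a u v; rewrite /alt [tens _ x](tens_linearl x a u v).
by rewrite [tens x _]tens_linearr scalerBr opprD addrACA.
Qed.

Definition ext2 : {vspace tensor m m} := bil_span alt fullv fullv.

Lemma mem_ext2 x y : alt x y \in ext2.
Proof. exact: (mem_bil_span alt_linearl alt_linearr (memvf x) (memvf y)). Qed.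

Lemma ext2P (W : {vspace tensor m m}) :
  reflect (forall x y, alt x y \in W) (ext2 <= W)%VS.
Proof.
apply: (iffP (bil_spanP alt_linearl alt_linearr _ _ _)) => h x y //.
by apply: h; rewrite memvf.
Qed.

Fact wedge_key : unit. Proof. by []. Qed.
Definition wedge_def (x y : m) : subvs_of ext2 := vsproj ext2 (alt x y).
Definition wedge := locked_with wedge_key wedge_def.
Canonical wedge_unlockable := [unlockable fun wedge].

Lemma vsval_wedge x y : vsval (wedge x y) = alt x y.
Proof. by rewrite [wedge]unlock vsprojK// mem_ext2. Qed.

Lemma wedge_linearl y : linear (wedge^~ y).
Proof.
by move=> a u v; apply/val_inj; rewrite /= !vsval_wedge [LHS]alt_linearl.
Qed.

Lemma wedge_linearr x : linear (wedge x).
Proof.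
by move=> a u v; apply/val_inj; rewrite /= !vsval_wedge [LHS]alt_linearr.
Qed.

HB.instance Definition _ x := GRing.isLinear.Build k m (subvs_of ext2) _
  (wedge x) (wedge_linearr x).

Lemma wedgexx x : wedge x x = 0.
Proof. by apply/val_inj; rewrite /= vsval_wedge [LHS]subrr. Qed.

Lemma wedgeC x y : wedge x y = - wedge y x.
Proof. by apply/val_inj; rewrite /= !vsval_wedge [RHS]opprB. Qed.

(* Natural action on /\^2 m, restricted from m (x) m *)
Fact ext2_act_key : unit. Proof. by []. Qed.
Definition ext2_act_def (delta : 'End(m)) : 'End(subvs_of ext2) :=
  linfun (vsproj ext2 \o tens_act delta delta \o vsval).
Definition ext2_act := locked_with ext2_act_key ext2_act_def.
Canonical ext2_act_unlockable := [unlockable fun ext2_act].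

Lemma tens_act_ext2 delta : (tens_act delta delta @: ext2 <= ext2)%VS.
Proof.
apply/subvP => _ /memv_imgP[t text ->]; rewrite memv_preim.
apply: (subvP _ t text); apply/ext2P => x y; rewrite -memv_preim.
rewrite /alt linearB /= !tens_actE.
rewrite opprD [- _ - _]addrC addrACA.
by rewrite rpredD ?mem_ext2.
Qed.

Lemma vsval_ext2_act delta a :
  vsval (ext2_act delta a) = tens_act delta delta (vsval a).
Proof.
rewrite [ext2_act]unlock lfunE /= vsprojK//.
apply: (subvP (tens_act_ext2 delta)).
by rewrite memv_img// subvsP.
Qed.

Lemma ext2_actE delta x y :
  ext2_act delta (wedge x y) = wedge (delta x) y + wedge x (delta y).
Proof.
apply/val_inj; rewrite /= vsval_ext2_act !vsval_wedge /alt linearB /=.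
rewrite !tens_actE.
by rewrite opprD [- _ - _]addrC addrACA.
Qed.

Local Notation tensor3 := (tensor m (subvs_of ext2)).

Definition s_gen (x y z : m) : tensor3 :=
  2%:R *: tens x (wedge y z) + tens y (wedge x z) + tens z (wedge y x).

Lemma s_gen_linear1 y z : linear (fun x => s_gen x y z).
Proof.
move=> a u v; rewrite /s_gen [tens _ (wedge y z)](tens_linearl _ a u v).
rewrite [wedge (a *: u + v) z](wedge_linearl z a u v).
rewrite [wedge y (a *: u + v)]wedge_linearr.
rewrite !tens_linearr !scalerDr !scalerA [2%:R * a]mulrC -!scalerA !addrA.
by rewrite [LHS](ACl (1*3*5*2*4*6)) /= ?addrA.
Qed.

Lemma s_gen_linear2 x z : linear (fun y => s_gen x y z).
Proof.
move=> a u v; rewrite /s_gen [tens _ (wedge x z)](tens_linearl _ a u v).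
rewrite [wedge (a *: u + v) z](wedge_linearl z a u v).
rewrite [wedge (a *: u + v) x](wedge_linearl x a u v).
rewrite !tens_linearr !scalerDr !scalerA [2%:R * a]mulrC -!scalerA !addrA.
by rewrite [LHS](ACl (1*3*5*2*4*6)) /= ?addrA.
Qed.

Lemma s_gen_linear3 x y : linear (s_gen x y).
Proof.
move=> a u v; rewrite /s_gen [tens _ (wedge y x)](tens_linearl _ a u v).
rewrite [wedge y (a *: u + v)]wedge_linearr.
rewrite [wedge x (a *: u + v)]wedge_linearr.
rewrite !tens_linearr !scalerDr !scalerA [2%:R * a]mulrC -!scalerA !addrA.
by rewrite [LHS](ACl (1*3*5*2*4*6)) /= ?addrA.
Qed.

(* Span of all the s_gen x y z ([s_spaceP]) *)
Definition s_space : {vspace tensor3} :=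
  (\sum_(i < \dim {:m}) bil_span (s_gen (vbasis {:m})`_i) fullv fullv)%VS.

Lemma mem_s x y z : s_gen x y z \in s_space.
Proof.
rewrite (coord_vbasis (memvf x)).
have := @bil_suml _ _ _ _ (fun x z => s_gen x y z) (s_gen_linear1 y) z.
move=> /= ->; apply: memv_suml => i _; rewrite memvZ//.
apply: (subvP (sumv_sup i _ (subvv _))) => //.
exact: (mem_bil_span (@s_gen_linear2 _) (@s_gen_linear3 _)
  (memvf y) (memvf z)).
Qed.

Lemma s_spaceP (W : {vspace tensor3}) :
  reflect (forall x y z, s_gen x y z \in W) (s_space <= W)%VS.
Proof.
apply: (iffP idP) => [sW x y z|sW]; first exact/(subvP sW)/mem_s.
apply/subv_sumP => i _.
by apply/(bil_spanP (@s_gen_linear2 _) (@s_gen_linear3 _)) => y z.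
Qed.

(* [x, a] for a in /\^2 m: the second term is the image of a under
   id (x) (x /\ _); [tri_wedge] is the value on a = y /\ z. *)
Fact tri_key : unit. Proof. by []. Qed.
Definition tri_def (x : m) (a : subvs_of ext2) : tensor3 :=
  (2%:R / 3%:R) *: tens x a + 3%:R^-1 *: tens_map (linfun (wedge x)) (vsval a).
Definition tri := locked_with tri_key tri_def.
Canonical tri_unlockable := [unlockable fun tri].

Lemma tri_wedge x y z :
  tri x (wedge y z) = (2%:R / 3%:R) *: tens x (wedge y z)
    + 3%:R^-1 *: tens y (wedge x z) + 3%:R^-1 *: tens z (wedge y x).
Proof.
rewrite [tri]unlock /tri_def vsval_wedge /alt linearB /= !tens_mapE !lfunE /=.
by rewrite [wedge y x]wedgeC linearN /= scalerBr scalerN addrA.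
Qed.

Lemma tri_linearl a : linear (tri^~ a).
Proof.
move=> c u v; rewrite [tri]unlock /tri_def /= [tens _ a](tens_linearl a c u v).
have -> : linfun (wedge (c *: u + v)) =
    c *: linfun (wedge u) + linfun (wedge v) :> 'Hom(m, subvs_of ext2).
  by apply/lfunP => x; rewrite !lfun_simp /= (wedge_linearl x c u v).
rewrite [tens_map _ _]tens_map_linearl !scalerDr !scalerA.
by rewrite [_ * c]mulrC [_^-1 * c]mulrC addrACA.
Qed.

Lemma tri_linearr x : linear (tri x).
Proof.
move=> c a b; rewrite [tri]unlock /tri_def tens_linearr linearP /=.
rewrite tens_map_linear !scalerDr !scalerA.
by rewrite [_ * c]mulrC addrACA.
Qed.

HB.instance Definition _ x := GRing.isLinear.Build k (subvs_of ext2) tensor3 _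
  (tri x) (tri_linearr x).

Lemma mem_tri x a : tri x a \in s_space.
Proof.
have triL : linear (tri x \o vsproj ext2)
  by move=> c u v; rewrite /= [vsproj _ _]linearP; exact: tri_linearr.
pose T : {linear tensor m m -> tensor3} :=
  HB.pack (tri x \o vsproj ext2) (GRing.isLinear.Build k _ _ _ _ triL).
have -> : tri x a = linfun T (vsval a) by rewrite lfunE /= vsvalK.
rewrite memv_preim; apply: (subvP _ _ (subvsP a)); apply/ext2P => y z.
rewrite -memv_preim lfunE /= -vsval_wedge vsvalK tri_wedge.
rewrite [2%:R / _]mulrC -scalerA -!scalerDr memvZ//; exact: mem_s.
Qed.

Lemma tri_jacobi (x y z : m) :
  tri x (wedge y z) + tri y (wedge z x) + tri z (wedge x y) = 0.
Proof.
rewrite !tri_wedge (wedgeC x z) (wedgeC y x) (wedgeC z y).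
rewrite !linearN /= ?scalerN.
set X := tens x _; set Y := tens y _; set Z := tens z _.
have e (W : tensor3) : (2%:R / 3%:R) *: W = 3%:R^-1 *: W + 3%:R^-1 *: W.
  by rewrite mulr_natl mulr2n scalerDl.
rewrite !e; set X' := _ *: X; set Y' := _ *: Y; set Z' := _ *: Z.
rewrite !addrA.
rewrite (ACl ((1*8)*(2*11)*(3*5)*(4*9)*(6*12)*(7*10))) /=.
by rewrite !(subrr, addNr, addr0).
Qed.

Lemma tri_alt_linear (y : m) b c u v a1 a2 :
  tri (c *: u + v) b - tri y (c *: a1 + a2) =
  c *: (tri u b - tri y a1) + (tri v b - tri y a2).
Proof.
rewrite [tri (c *: u + v) b](tri_linearl b c u v) [tri y (_ + _)]tri_linearr.
by rewrite scalerBr opprD addrACA.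
Qed.

End Exterior.

Section N2.

Variables (k : fieldType) (m : vectType k).

Definition N2 : Type := (m * subvs_of (ext2 m))%type.

HB.instance Definition _ := Vector.on N2.

(* [N2_ext2], [N3_m], [N3_ext2s], [N3_s] below are the summands /\^2 m, m,
   /\^2 m + s and s as subspaces of N(m,2) and N(m,3). *)
Definition N2_bracket (p q : N2) : N2 := (0, wedge p.1 q.1).

Lemma N2_linearl q : linear (N2_bracket^~ q).
Proof.
move=> a u v; congr (_, _); first by rewrite /= scaler0 addr0.
exact: (wedge_linearl q.1 a u.1 v.1).
Qed.

Lemma N2_linearr p : linear (N2_bracket p).
Proof.
move=> a u v; congr (_, _); first by rewrite /= scaler0 addr0.
exact: (wedge_linearr p.1 a u.1 v.1).
Qed.

Lemma N2_alt p : N2_bracket p p = 0.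
Proof. by rewrite /N2_bracket wedgexx. Qed.

Lemma N2_jacobi p q r : N2_bracket p (N2_bracket q r) +
  N2_bracket q (N2_bracket r p) + N2_bracket r (N2_bracket p q) = 0.
Proof. by rewrite /N2_bracket /= !linear0 !addr0. Qed.

HB.instance Definition _ := Vector_isLie.Build k N2
  N2_linearl N2_linearr N2_alt N2_jacobi.

Definition N2_gen (x : m) : N2 := (x, 0).

Definition N2_ext2 : {vspace N2} :=
  lker (linfun (fst : m * subvs_of (ext2 m) -> m)).

Lemma mem_N2_ext2 (p : N2) : (p \in N2_ext2) = (p.1 == 0).
Proof. by rewrite memv_ker lfunE. Qed.

End N2.

Section N3.

Variables (k : fieldType) (m : vectType k).

Definition N3 : Type :=
  (m * subvs_of (ext2 m) * subvs_of (s_space m))%type.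

HB.instance Definition _ := Vector.on N3.

Definition N3_bracket (p q : N3) : N3 :=
  (0, wedge p.1.1 q.1.1,
   vsproj (s_space m) (tri p.1.1 q.1.2 - tri q.1.1 p.1.2)).

Lemma N3_linearl q : linear (N3_bracket^~ q).
Proof.
move=> a u v; congr (_, _, _); first by rewrite /= scaler0 addr0.
  exact: (wedge_linearl q.1.1 a u.1.1 v.1.1).
have E := congr1 (vsproj (s_space m))
  (tri_alt_linear q.1.1 q.1.2 a u.1.1 v.1.1 u.1.2 v.1.2).
exact: (etrans E (linearP (vsproj (s_space m)) _ _ _)).
Qed.

Lemma N3_alt p : N3_bracket p p = 0.
Proof. by rewrite /N3_bracket wedgexx subrr linear0. Qed.

Lemma N3_linearr p : linear (N3_bracket p).
Proof.
have NC q : N3_bracket p q = - N3_bracket q p.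
  rewrite /N3_bracket [wedge q.1.1 _]wedgeC -[tri q.1.1 _ - _]opprB linearN.
  by congr (_, _, _) => /=; rewrite ?oppr0 ?opprK.
move=> a u v; rewrite !NC [N3_bracket (a *: u + v) p]N3_linearl.
by rewrite opprD scalerN.
Qed.

Lemma N3_jacobi p q r : N3_bracket p (N3_bracket q r) +
  N3_bracket q (N3_bracket r p) + N3_bracket r (N3_bracket p q) = 0.
Proof.
have tri0 a : tri (0 : m) a = 0.
  have := tri_linearl a (-1) 0 0.
  by rewrite /= addr0 !scaleN1r oppr0 addNr.
rewrite /N3_bracket /= !tri0 !subr0 !linear0.
congr (_, _, _); rewrite /= ?addr0//.
by rewrite -!linearD /= tri_jacobi linear0.
Qed.

HB.instance Definition _ := Vector_isLie.Build k N3
  N3_linearl N3_linearr N3_alt N3_jacobi.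

Definition N3_gen (x : m) : N3 := (x, 0, 0).

Lemma N3_gen_linear : linear N3_gen.
Proof.
by move=> a u v; congr (_, _, _); rewrite /= scaler0 addr0.
Qed.

HB.instance Definition _ := GRing.isLinear.Build k m N3 _ N3_gen N3_gen_linear.

Definition N3_m : {vspace N3} := limg (linfun N3_gen).

Definition N3_ext2s : {vspace N3} :=
  lker (linfun ((fst : m * _ -> _) \o
    (fst : m * subvs_of (ext2 m) * subvs_of (s_space m) -> _))).

Definition N3_s : {vspace N3} :=
  lker (linfun (fst : m * subvs_of (ext2 m) * subvs_of (s_space m) -> _)).

Lemma mem_N3_m (p : N3) : (p \in N3_m) = (p.1.2 == 0) && (p.2 == 0).
Proof.
apply/memv_imgP/andP => [[x _ ->]|[/eqP p2 /eqP p3]].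
  by rewrite (lfunE N3_gen) /=.
exists p.1.1; rewrite ?memvf// (lfunE N3_gen) /=.
by case: p p2 p3 => [[x a] t] /= -> ->.
Qed.

Lemma mem_N3_ext2s (p : N3) : (p \in N3_ext2s) = (p.1.1 == 0).
Proof. by rewrite memv_ker (lfunE (fst \o fst)). Qed.

Lemma mem_N3_s (p : N3) : (p \in N3_s) = (p.1.1 == 0) && (p.1.2 == 0).
Proof. by rewrite memv_ker lfunE -xpair_eqE; case: p => [[]]. Qed.

End N3.

Section N3Products.

Variables (k : fieldType) (m : vectType k).
Implicit Types x y z : m.

Lemma tri0l a : tri (0 : m) a = 0.
Proof.
have := tri_linearl a (-1) 0 0.
by rewrite /= addr0 !scaleN1r oppr0 addNr.
Qed.

Lemma N3_lie_gen x y : lie (N3_gen x) (N3_gen y) = (0, wedge x y, 0).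
Proof.
congr (_, _, _) => /=.
by rewrite [tri x 0]linear0 [tri y 0]linear0 subrr linear0.
Qed.

Lemma N3_lie_wedge x y z :
  [/\ (lie (N3_gen x) ((0, wedge y z, 0) : N3 m)).1 = 0 &
      vsval (lie (N3_gen x) ((0, wedge y z, 0) : N3 m)).2 =
        (2%:R / 3%:R) *: tens x (wedge y z)
        + 3%:R^-1 *: tens y (wedge x z) + 3%:R^-1 *: tens z (wedge y x)].
Proof.
split; first by rewrite [lie _ _]/(N3_bracket _ _) /N3_bracket /= linear0.
rewrite [lie _ _]/(N3_bracket _ _) /N3_bracket /= linear0 subr0.
by rewrite vsprojK ?mem_tri// tri_wedge.
Qed.

End N3Products.

Section Levi.

Variable k : fieldType.

Definition is_levi_extension (S R : lieAlgType k) (sigma : 'Hom(S, gl R)) :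
    Prop :=
  [/\ semisimple S, solvable R, is_lie_hom sigma
    & forall s, is_derivation (sigma s : 'End(R))].

Definition is_faithful (S R : lieAlgType k) (sigma : 'Hom(S, gl R)) : Prop :=
  lker sigma = 0%VS.

Variables (m : vectType k) (S : subalgebra (gl m)).

(* N admits S as a faithful Levi extension and the S-module N / N^2 is the
   natural module m: phi induces an S-isomorphism N / N^2 -> m. *)
Definition admits_faithful_levi (N : lieAlgType k) : Prop :=
  exists sigma : 'Hom(sub_lie S, gl N),
    [/\ is_levi_extension sigma, is_faithful sigma
      & exists phi : 'Hom(N, m),
        [/\ lker phi = lower_central N 2, limg phi = fullv
          & forall (s : sub_lie S) (x : N),
              phi ((sigma s : 'End(N)) x) = (vsval s : 'End(m)) (phi x)]].

(* The derivation D of L extends delta, for m embedded in L by iota *)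
Definition is_extension (L : lieAlgType k) (iota : m -> L) (delta : 'End(m))
    (D : 'End(L)) : Prop :=
  is_derivation D /\ forall x, D (iota x) = iota (delta x).

Definition is_submodule (L : lieAlgType k) (iota : m -> L) (J : {vspace L}) :
    Prop :=
  forall delta D, delta \in (S : {vspace gl m}) -> is_extension iota delta D ->
    (D @: J <= J)%VS.

End Levi.

(* Main.v *)
(* A t-nilpotent N with a faithful Levi action of S such that N / [N, N] is the
   natural module m is generated by any linear section of N -> m, hence is a
   quotient of the free t-nilpotent algebra on m. If the section is
   S-equivariant, the projection intertwines the action of S on N with the
   derivations extending the elements of S, and its kernel is a submodule; it
   lies in the derived algebra, and omits part of the last layer because the
   t-th term of the lower central series of N is nonzero. Conversely the
   derivations extending S descend to the quotient by a stable ideal.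

   An equivariant section exists by complete reducibility, i.e. the vanishing of
   the first cohomology of S. Cartan's criterion is proved over a field
   splitting a characteristic polynomial, with integer-valued additive functions
   of the eigenvalues in place of rational linear forms; with Engel's theorem it
   gives nondegenerate trace forms, hence Casimir elements of nonzero trace,
   which act invertibly on a nonzero Fitting component. *)
Require Import Defs.
From HB Require Import structures.
From mathcomp Require Import all_boot all_order all_algebra all_field ring.
From Stdlib Require Import Classical.

Set Implicit Arguments.
Unset Strict Implicit.
Unset Printing Implicit Defensive.

Import Num.Theory GRing.Theory.
Local Open Scope ring_scope.

(** * Cartan's trace criterion for matrices *)

(** Semisimplicity is available only as the absence of solvable ideals, over a field that need not
    be algebraically closed. Cartan's criterion is therefore used twice. On the adjoint
    representation it makes every ideal perfect. On an arbitrary module it then places the radical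
    of the trace form in the kernel, because that radical is an ideal and so equals all its derived
    ideals.

    Submodules never change the size of the matrices: they are encoded as idempotents commuting with
    the action. No reduction to irreducible modules is made; one Fitting component is removed at a
    time. *)

Lemma irreducible_divisor (F : fieldType) (p : {poly F}) :
  (1 < size p)%N -> exists2 q, irreducible_poly q & q %| p.
Proof.
have [n] := ubnP (size p); elim: n p => // n IH p /ltnSE le_pn p_gt1.
case: (classic (forall q : {poly F}, size q != 1 -> q %| p -> q %= p)).
  by exists p; rewrite ?dvdpp.
case/not_all_ex_not=> q Hq; have [q_n1 {}Hq] := imply_to_and _ _ Hq.
have [q_p q'p] := imply_to_and _ _ Hq.
have p0 : p != 0 by rewrite -size_poly_gt0 ltnW.
have q0 : q != 0 by apply: contraNneq p0 => q0; rewrite q0 dvd0p in q_p.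
have q_gt1 : (1 < size q)%N.
  by rewrite ltn_neqAle eq_sym q_n1 size_poly_gt0.
have lt_qp : (size q < size p)%N.
  rewrite ltn_neqAle dvdp_leq// andbT; apply/negP => eq_qp.
  by apply: q'p; rewrite -dvdp_size_eqp.
have [r irr_r r_q] := IH q (leq_trans lt_qp le_pn) q_gt1.
by exists r => //; apply: dvdp_trans q_p.
Qed.

(** Asking only for a ring morphism into [K], not for an extension structure over [F], lets the
    one-root extensions be composed without building a tower. *)
Lemma splitting_extension (F : fieldType) (p : {poly F}) : p != 0 ->
  exists (K : fieldType) (iota : {rmorphism F -> K}) (s : seq K),
    map_poly iota p %= \prod_(a <- s) ('X - a%:P).
Proof.
have [n] := ubnP (size p); elim: n F p => // n IH F p /ltnSE le_pn p0.
have [p_le1|p_gt1] := leqP (size p) 1.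
  exists F, idfun, [::]; rewrite big_nil map_polyE map_id polyseqK.
  by rewrite -size_poly_eq1 eqn_leq p_le1 size_poly_gt0.
have [q irr_q q_p] := irreducible_divisor p_gt1.
have [L _ [z qz _]] := irredp_FAdjoin irr_q.
have pz : root (map_poly (in_alg L) p) z.
  by apply: root_dvdp qz; rewrite dvdp_map.
have [p1 Dp] := factor_theorem _ _ pz.
have p10 : p1 != 0.
  apply: contraNneq p0 => p10; move: Dp; rewrite p10 mul0r => /eqP.
  by rewrite map_poly_eq0.
have lt_p1 : (size p1 < size p)%N.
  by rewrite -(size_map_poly (in_alg L) p) Dp size_Mmonic ?monicXsubC//
    size_XsubC addn2.
have [K [iota [s Ds]]] := IH L p1 (leq_trans lt_p1 le_pn) p10.
exists K, (iota \o in_alg L), (iota z :: s).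
rewrite map_poly_comp Dp rmorphM /= map_polyXsubC big_cons mulrC.
by rewrite eqp_mull.
Qed.

(** * Chinese remainders for powers of linear polynomials *)

Section PolyCRT.

Variable K : fieldType.
Implicit Types (s : seq K) (p q : {poly K}).

Lemma coprimep_prod_XsubC_exp (a : K) N s : a \notin s ->
  coprimep (('X - a%:P) ^+ N) (\prod_(b <- s) ('X - b%:P) ^+ N).
Proof.
elim: s => [|b s IH]; first by rewrite big_nil coprimep1.
rewrite inE negb_or big_cons => /andP[ab /IH cop].
rewrite coprimepMr cop andbT coprimep_expl// coprimep_expr//.
by rewrite coprimep_XsubC2 ?subr_eq0 1?eq_sym.
Qed.

Lemma dvdp_prod_XsubC_exp N s p : uniq s ->
  {in s, forall a, ('X - a%:P) ^+ N %| p} ->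
  \prod_(a <- s) ('X - a%:P) ^+ N %| p.
Proof.
elim: s => [|a s IH] /= => [_ _|/andP[a's us] ps].
  by rewrite big_nil dvd1p.
rewrite big_cons Gauss_dvdp ?coprimep_prod_XsubC_exp//.
by rewrite ps ?mem_head// IH// => b sb; rewrite ps// inE sb orbT.
Qed.

Lemma poly_interpolation N s (h : K -> K) : uniq s ->
  exists p, {in s, forall a, ('X - a%:P) ^+ N %| p - (h a)%:P}.
Proof.
elim: s => [|a s IH] /= => [_|/andP[a's us]]; first by exists 0.
have [p ps] := IH us.
have /Bezout_eq1_coprimepP[[u v] /= uv] := coprimep_prod_XsubC_exp N a's.
set P := \prod_(b <- s) _ in uv.
(* [v * P] is 1 modulo the power at [a] and 0 modulo the powers at the elements of [s], so the
   correction changes [p] only at [a]. *)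
exists (p + v * P * ((h a)%:P - p)) => b; rewrite inE => /predU1P[->|sb].
  have -> : v * P = 1 - u * ('X - a%:P) ^+ N by rewrite -uv addrC addKr.
  set D := _ ^+ N; have -> : p + (1 - u * D) * ((h a)%:P - p) - (h a)%:P =
    D * (u * (p - (h a)%:P)) by ring.
  exact: dvdp_mulr.
rewrite addrAC dvdp_add ?ps// dvdp_mulr// dvdp_mull//.
by rewrite /P (big_rem b)//= dvdp_mulr.
Qed.

End PolyCRT.

(** A substitute for a rational basis of the span of [s]: [D] is a common denominator and the
    [z c j] are integer coordinates. Independence comes from choosing [r] minimal, since a
    nontrivial relation would eliminate one of the [b j]. *)
Lemma int_coords (K : fieldType) (s : seq K) :
  exists (r : nat) (b : 'I_r -> K) (D : int) (z : K -> 'I_r -> int),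
  [/\ D != 0, {in s, forall c, D%:~R * c = \sum_j (z c j)%:~R * b j}
    & forall w : 'I_r -> int, \sum_j (w j)%:~R * b j = 0 -> w =1 fun=> 0].
Proof.
pose P r := exists (b : 'I_r -> K) (D : int) (z : K -> 'I_r -> int),
  D != 0 /\ {in s, forall c, D%:~R * c = \sum_j (z c j)%:~R * b j}.
have exP : exists r, P r.
  exists (size s), (fun j => s`_j), 1, (fun c j => (index c s == val j)%:R).
  split=> // c sc; have cs : (index c s < size s)%N by rewrite index_mem.
  rewrite mul1r (bigD1 (Ordinal cs))//= eqxx mul1r nth_index// big1 ?addr0//.
  by move=> j; rewrite -val_eqE /= eq_sym => /negPf->; rewrite mul0r.
have [r Pr minr] : exists2 r, P r & forall r', (r' < r)%N -> ~ P r'.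
  case: exP => r; have [n] := ubnP r; elim: n r => // n IH r /ltnSE rn Pr.
  have [[r' [r'r Pr']]|nP] := classic (exists r', (r' < r)%N /\ P r').
    exact: IH (leq_trans r'r rn) Pr'.
  by exists r => // r' r'r Pr'; apply: nP; exists r'.
case: r Pr minr => [|r] [b [D [z [D0 Dz]]]] minr.
  by exists 0%N, b, D, z; split=> // w _ [].
exists r.+1, b, D, z; split=> // w w0 i; apply/eqP/negPn/negP => wi.
case: (minr r (ltnSn r)).
(* Multiply the expression of [D c] by [w i] and replace [w i b i] by minus the sum of the other
   [w j b j]. *)
exists (fun j => b (lift i j)), (D * w i),
  (fun c j => z c (lift i j) * w i - z c i * w (lift i j)).
split=> [|c sc]; first by rewrite mulf_neq0.
rewrite rmorphM /= mulrAC Dz//.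
have {}w0 : \sum_j (w (lift i j))%:~R * b (lift i j) = - ((w i)%:~R * b i).
  by apply/eqP; rewrite -addr_eq0 addrC -[X in _ == X]w0 (bigD1_ord i).
under [RHS]eq_bigr => j _ do
  rewrite rmorphB !rmorphM/= mulrBl mulrAC -[X in _ - X]mulrA.
rewrite sumrB -mulr_suml -mulr_sumr w0 mulrN opprK mulrA.
by rewrite (bigD1_ord i)//= mulrDl addrC [_ * b i * _]mulrAC.
Qed.

Lemma exprS_mulmxC (R : pzRingType) m n (B : 'M[R]_(m, n))
  (C : 'M[R]_(n, m)) j :
  (B *m C) ^+ j.+1 = B *m (C *m B) ^+ j *m C.
Proof.
elim: j => [|j IHj]; first by rewrite expr1 expr0 mulmx1.
have -> : (C *m B) ^+ j.+1 = C *m B *m (C *m B) ^+ j by rewrite exprS.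
have -> : (B *m C) ^+ j.+2 = B *m C *m (B *m C) ^+ j.+1 by rewrite exprS.
by rewrite IHj !mulmxA.
Qed.

(** No eigenvalues are involved: for a rank factorization A = C R, the trace of A is that of R C,
    which is again nilpotent and has size the rank of A, smaller than [n]. *)
Lemma mxtrace_nilpotent (F : fieldType) n (A : 'M[F]_n) N :
  A ^+ N = 0 -> \tr A = 0.
Proof.
have [m] := ubnP n; elim: m n N A => // m IH [|n] N A nm AN.
  by rewrite [A]flatmx0 mxtrace0.
have [r_lt|r_ge] := ltnP (\rank A) n.+1; last first.
  have : A ^+ N \is a GRing.unit.
    by rewrite unitrX// -[_ \is a _]row_free_unit
      /row_free eqn_leq rank_leq_row.
  by rewrite AN unitr0.
rewrite -[A in \tr A]mulmx_base mxtrace_mulC.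
apply: (IH _ N.+1); first exact: leq_trans r_lt _.
by rewrite exprS_mulmxC mulmx_base AN mulmx0 mul0mx.
Qed.

(** For a rank factorization A = C R, idempotence reads C (R C) R = C R; cancelling C and R leaves R
    C = 1, in size the rank of A. *)
Lemma mxtrace_idempotent (F : fieldType) n (A : 'M[F]_n) :
  A *m A = A -> \tr A = (\rank A)%:R.
Proof.
move=> AA; rewrite -[A in LHS]mulmx_base mxtrace_mulC.
suff -> : row_base A *m col_base A = 1%:M by rewrite mxtrace1.
move: (col_base A) (row_base A) (col_base_full A) (row_base_free A)
  (mulmx_base A) => C R Cfull Rfree CR.
apply: (row_full_inj Cfull); apply: (row_free_inj Rfree).
by rewrite /= mulmx1 CR !mulmxA CR -mulmxA CR.
Qed.

Section PrimaryDecomposition.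

Variables (K : fieldType) (n' N : nat) (s : seq K).
Local Notation n := n'.+1.
Variable A : 'M[K]_n.
Hypothesis us : uniq s.
Hypothesis As : horner_mx A (\prod_(a <- s) ('X - a%:P) ^+ N) = 0.

Lemma horner_mx_congr p : {in s, forall a, ('X - a%:P) ^+ N %| p} ->
  horner_mx A p = 0.
Proof.
move=> /(dvdp_prod_XsubC_exp us)/dvdpP[q ->].
by rewrite rmorphM /= As mulr0.
Qed.

(* E a is the projector onto the generalized eigenspace of a. *)
Lemma spectral_projectors : exists E : K -> 'M[K]_n,
  [/\ \sum_(a <- s) E a = 1,
      forall a, E a * E a = E a,
      forall a, GRing.comm A (E a),
      {in s, forall a, (A - a%:M) ^+ N * E a = 0}
    & forall p (h : K -> K), {in s, forall a,
      ('X - a%:P) ^+ N %| p - (h a)%:P} ->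
      {in s, forall a, horner_mx A p * E a = h a *: E a}].
Proof.
have [e eP] : exists e : K -> {poly K}, forall a,
    {in s, forall b, ('X - b%:P) ^+ N %| e a - (b == a)%:R%:P}.
  pose P a := [pred p : {poly K} |
    all (fun b => ('X - b%:P) ^+ N %| p - (b == a)%:R%:P) s].
  have ex a : exists p, P a p.
    have [p pP] := poly_interpolation N (fun b => (b == a)%:R) us.
    by exists p; apply/allP.
  by exists (fun a => xchoose (ex a)) => a; apply/allP/(xchooseP (ex a)).
exists (fun a => horner_mx A (e a)); split.
- rewrite -rmorph_sum -[RHS](rmorph1 (horner_mx A)) /=.
  apply/eqP; rewrite -subr_eq0 -rmorphB; apply/eqP/horner_mx_congr => b sb.
  rewrite (bigD1_seq b)//= -addrAC dvdp_add//.
    by have := eP b b sb; rewrite eqxx.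
  rewrite big_seq_cond; apply: (big_ind (fun p => _ %| p)).
  - exact: dvdp0.
  - by move=> p q; exact: dvdp_add.
  by move=> a /andP[_ /negPf ab]; have := eP a b sb; rewrite eq_sym ab subr0.
- move=> a; apply/eqP; rewrite -rmorphM -subr_eq0 -rmorphB; apply/eqP.
  apply: horner_mx_congr => b /(eP a).
  have -> : e a * e a - e a = e a * (e a - 1) by ring.
  by case: (b == a); rewrite ?subr0 => dv;
    [rewrite dvdp_mull | rewrite dvdp_mulr].
- by move=> a; apply: comm_mx_horner.
- move=> a sa.
  have -> : (A - a%:M) ^+ N = horner_mx A (('X - a%:P) ^+ N).
    by rewrite rmorphXn rmorphB /= horner_mx_X horner_mx_C.
  rewrite -rmorphM; apply: horner_mx_congr => b sb.
  have := eP a b sb; have [->|] := eqVneq b a; first by rewrite dvdp_mulr.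
  by rewrite subr0 => _ dv; rewrite dvdp_mull.
move=> p h ph a sa.
apply/eqP; rewrite -mul_scalar_mx -[(h a)%:M](horner_mx_C A) -rmorphM -subr_eq0.
rewrite -[_ *m _]rmorphM -rmorphB; apply/eqP; apply: horner_mx_congr => b sb.
rewrite -mulrBl; have := eP a b sb; have [->|] := eqVneq b a.
  by rewrite dvdp_mulr// ph.
by rewrite subr0 => _ dv; rewrite dvdp_mull.
Qed.

End PrimaryDecomposition.

Section AdMx.

Import FalgLfun.

Variables (K : fieldType) (n' : nat).
Local Notation n := n'.+1.
Implicit Types (A B M : 'M[K]_n).

(** Taken in the algebra of endomorphisms of the matrix space, so that polynomials in ad A make
    sense and it is a difference of two commuting operators. *)
Definition ad_mx A : 'End('M[K]_n) := amull A - amulr A.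

Lemma ad_mxE A M : ad_mx A M = A * M - M * A.
Proof. by rewrite /ad_mx add_lfunE opp_lfunE !lfunE. Qed.

Lemma amull_exp A j M : (amull A ^+ j) M = A ^+ j * M.
Proof.
elim: j M => [|j IH] M; first by rewrite !expr0 mul1r id_lfunE.
by rewrite exprS lfun_mulE IH lfunE /= mulrA -exprSr.
Qed.

Lemma amulr_exp A j M : (amulr A ^+ j) M = M * A ^+ j.
Proof.
elim: j M => [|j IH] M; first by rewrite !expr0 mulr1 id_lfunE.
by rewrite exprSr lfun_mulE IH lfunE /= exprSr mulrA.
Qed.

Lemma amull_amulr_comm A B : GRing.comm (amull A) (amulr B).
Proof. by apply/lfunP => M; rewrite !lfun_mulE !lfunE /= mulrA. Qed.

(** In each term of the binomial expansion of exponent [N + N], either A stands at least N times on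
    the left of M or B at least N times on its right. *)
Lemma amullr_exp_eq0 A B N M : A ^+ N * M = 0 -> M * B ^+ N = 0 ->
  ((amull A - amulr B) ^+ (N + N)) M = 0.
Proof.
move=> AM MB; rewrite exprBn_comm; last exact: amull_amulr_comm.
rewrite sum_lfunE big1// => i _.
suff E : (amull A ^+ (N + N - i) * amulr B ^+ i) M = 0.
  rewrite -scaler_nat scale_lfunE -mulrA -signr_odd mulr_sign.
  by case: (odd _); rewrite ?opp_lfunE E ?oppr0 scaler0.
rewrite lfun_mulE amull_exp amulr_exp.
have [le_Ni|lt_iN] := leqP N i.
  suff MBi : M * B ^+ i = 0 by rewrite -mulrA MBi mulr0.
  by rewrite -(subnKC le_Ni) exprD mulrA MB mul0r.
rewrite -(subnK (_ : N <= N + N - i)%N);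
  last by rewrite -addnBA ?leq_addr// ltnW.
by rewrite exprD -[_ * M]mulrA AM mulr0 mul0r.
Qed.

Lemma amull_sub_scalar A a : amull (A - a%:M) = amull A - a%:A.
Proof. by rewrite linearB /= -scalemx1 linearZ /= amull1. Qed.

Lemma amulr_sub_scalar A a : amulr (A - a%:M) = amulr A - a%:A.
Proof. by rewrite linearB /= -scalemx1 linearZ /= rmorph1. Qed.

Lemma horner_alg_apply (T : 'End('M[K]_n)) (P : {poly K}) M :
  (horner_alg T P) M = \sum_(i < size P) P`_i *: (T ^+ i) M.
Proof.
rewrite -{1}[P]coefK poly_def rmorph_sum sum_lfunE; apply: eq_bigr => i _.
rewrite -mul_polyC rmorphM rmorphXn /= horner_algC horner_algX mulr_algl.
by rewrite scale_lfunE.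
Qed.

Lemma ad_mx_exp A j M : (ad_mx A ^+ j) M = iter j (fun B => A * B - B * A) M.
Proof.
elim: j => [|j IH]; first by rewrite expr0 id_lfunE.
by rewrite exprSr lfun_mulE IH ad_mxE.
Qed.

End AdMx.

Section TraceCriterion.

Import FalgLfun.

Variables (K : fieldType) (n' : nat).
Local Notation n := n'.+1.
Hypothesis K0 : [pchar K] =i pred0.

Lemma intr_inj_char0 : injective (fun z : int => z%:~R : K).
Proof.
have nat0 := (@pcharf0P K).1 K0.
move=> x y; rewrite /= => /eqP; rewrite -subr_eq0 -rmorphB /= => /eqP xy0.
apply/eqP; rewrite -subr_eq0; move: xy0; case: (x - y) => m.
  by rewrite -pmulrn => /eqP; rewrite nat0 => /eqP->.
by rewrite NegzE rmorphN /= => /eqP; rewrite oppr_eq0 -pmulrn nat0.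
Qed.

(* If p(A) acts on the generalized eigenspace of a as the scalar h a, then
   [p(A), _] acts as h a - h b = h' (a - b) on the (a, b) block, where ad A has
   the single eigenvalue a - b: so it is the polynomial P in ad A. *)
Lemma ad_mx_horner_spectral N (s : seq K) (A : 'M[K]_n)
    (h h' : K -> K) (p : {poly K}) :
  uniq s -> horner_mx A (\prod_(a <- s) ('X - a%:P) ^+ N) = 0 ->
  {in s, forall a, ('X - a%:P) ^+ N %| p - (h a)%:P} ->
  {in s &, forall a b, h' (a - b) = h a - h b} ->
  exists P, forall M, horner_mx A p * M - M * horner_mx A p =
    \sum_(i < size P) P`_i *: iter i (fun B => A * B - B * A) M.
Proof.
move=> us As ph hh'.
have [E [E1 EE AE nilE pE]] := spectral_projectors us As.
(* The exponent doubles because ad A - (a - b) is a difference of left and right multiplications,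
   each killed at exponent [N] on the (a, b) block. Distinct pairs may share a difference, hence
   [undup]. *)
have [P Ph'] := poly_interpolation (N + N) h'
  (undup_uniq [seq a - b | a <- s, b <- s]).
exists P => M.
under eq_bigr => i _ do rewrite -ad_mx_exp.
rewrite -horner_alg_apply -(ad_mxE (horner_mx A p)).
have -> : M = \sum_(a <- s) \sum_(b <- s) E a * M * E b.
  under eq_bigr => a _ do rewrite -mulr_sumr E1 mulr1.
  by rewrite -mulr_suml E1 mul1r.
rewrite !linear_sum big_seq [in RHS]big_seq; apply: eq_bigr => a sa.
rewrite !linear_sum big_seq [in RHS]big_seq; apply: eq_bigr => b sb.
have Ep : GRing.comm (horner_mx A p) (E b).
  by apply/commr_sym/comm_mx_horner/commr_sym/AE.
rewrite /= -mulrA; set EM := E a * (M * E b).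
transitivity (h' (a - b) *: EM).
  rewrite ad_mxE /EM mulrA (pE p h)// -!mulrA -Ep (pE p h)// hh'// scalerBl.
  by rewrite -scalerAl -!scalerAr.
have sab : a - b \in undup [seq a - b | a <- s, b <- s].
  by rewrite mem_undup; apply/allpairsP; exists (a, b).
have /dvdpP[q Pq] := Ph' _ sab.
have {Pq} -> : P = ('X - (a - b)%:P) ^+ (N + N) * q + (h' (a - b))%:P.
  by rewrite mulrC -Pq subrK.
have ad_shift : horner_alg (ad_mx A) ('X - (a - b)%:P) =
    amull (A - a%:M) - amulr (A - b%:M).
  rewrite [LHS](rmorphB (horner_alg (ad_mx A))) /= horner_algX horner_algC.
  rewrite amull_sub_scalar amulr_sub_scalar.
  by rewrite scalerBl !opprB addrACA [RHS]addrACA [- _ - a%:A]addrC.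
rewrite rmorphD rmorphM rmorphXn /= horner_algC ad_shift.
rewrite add_lfunE lfun_mulE scale_lfunE id_lfunE amullr_exp_eq0
  ?linear0 ?add0r//.
  by rewrite /EM (mulrA _ (E a)) (nilE a sa) mul0r.
have comA : GRing.comm ((A - b%:M) ^+ N) (E b).
  apply/commr_sym/commrX/commrB; first exact/commr_sym/AE.
  exact: comm_mx_scalar.
by rewrite /EM -!mulrA -comA (nilE b sb) !mulr0.
Qed.

(* Cartan's argument: for h additive on the eigenvalues, with integer values,
   tr (p(A) A) vanishes by the previous lemma, and it is the sum of the
   (h a) a (\rank (E a)); applying h once more, the sum of the
   (h a)^2 (\rank (E a)) is 0. *)
Lemma nilpotent_of_trace_split N (s : seq K) (A : 'M[K]_n) (I : finType)
    (Y Z : I -> 'M[K]_n) :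
  uniq s -> horner_mx A (\prod_(a <- s) ('X - a%:P) ^+ N) = 0 ->
  A = \sum_i (Y i * Z i - Z i * Y i) ->
  (forall i j, \tr (iter j (fun B => A * B - B * A) (Y i) * Z i) = 0) ->
  A ^+ N = 0.
Proof.
move=> us As AE tr0.
have [E [E1 EE EA nilE pE]] := spectral_projectors us As.
(* The differences are included because [z] is a mere function: its additivity on them, [zB],
   follows from the independence of [b]. *)
have [r [b [D [z [D0 Dz indep]]]]] :=
  int_coords (s ++ [seq a - b | a <- s, b <- s]).
have zB j : {in s &, forall a c, z (a - c) j = z a j - z c j}.
  move=> a c sa sc; apply/eqP; rewrite -subr_eq0; apply/eqP.
  apply: (indep (fun j => z (a - c) j - (z a j - z c j))).
  under eq_bigr do rewrite !rmorphB !mulrBl.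
  rewrite !sumrB -!Dz ?mem_cat ?sa ?sc ?orbT//.
    by rewrite mulrBr subrr.
  by apply/orP; right; apply/allpairsP; exists (a, c).
have trA j : \sum_(a <- s) (z a j)%:~R * a * (\rank (E a))%:R = 0 :> K.
  have [p ph] := poly_interpolation N (fun a => (z a j)%:~R) us.
  have [P pP] := ad_mx_horner_spectral (h' := fun a => (z a j)%:~R) us As ph
    (fun a c sa sc => etrans (congr1 _ (zB j a c sa sc)) (rmorphB _ _ _)).
  have : \tr (horner_mx A p * A) = 0.
    (* By cyclicity tr (p(A) [Y, Z]) = tr ([p(A), Y] Z), and [p(A), Y] is a combination of the
       iterates of ad A on Y. *)
    rewrite [X in _ * X]AE mulr_sumr raddf_sum big1// => i _.
    transitivity (\tr ((horner_mx A p * Y i - Y i * horner_mx A p) * Z i)).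
      rewrite mulrBr mulrBl !raddfB /= !mulrA; congr (_ - _).
      by rewrite mxtrace_mulC mulmxE mulrA.
    rewrite pP mulr_suml raddf_sum big1// => l _.
    by rewrite /= -scalerAl mxtraceZ tr0 mulr0.
  rewrite -[X in _ * X]mulr1 -E1 !mulr_sumr raddf_sum => trpA.
  rewrite -[RHS]trpA big_seq [RHS]big_seq; apply: eq_bigr => a sa.
  rewrite /= EA mulrA (pE p (fun a => (z a j)%:~R))// -scalerAl mxtraceZ -mulrA.
  have <- : \tr (E a) = (\rank (E a))%:R by exact: mxtrace_idempotent (EE a).
  congr (_ * _); rewrite -mxtraceZ; apply/eqP; rewrite -subr_eq0 -raddfB /=.
  have -> : a *: E a - E a * A = - ((A - a%:M) * E a).
    by rewrite mulrBl opprB EA -[a%:M]scalemx1 -scalerAl mul1r.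
  (* [N.+1] rather than [N]: a power of [E a] equals [E a] only for a positive exponent, and [N] may
     be 0. *)
  rewrite raddfN oppr_eq0; apply/eqP; apply: (@mxtrace_nilpotent _ _ _ N.+1).
  have comE : GRing.comm (A - a%:M) (E a).
    by apply/commr_sym/commrB; [exact/commr_sym/EA | exact: comm_mx_scalar].
  have idE i : E a ^+ i.+1 = E a by elim: i => // i IH; rewrite exprS IH EE.
  by rewrite exprMn_comm// idE exprS -mulrA nilE// mulr0.
have E0 a : a \in s -> a != 0 -> E a = 0.
  move=> sa a0; apply/eqP; rewrite -mxrank_eq0; apply: contraNT a0 => ra.
  have za j : z a j = 0.
    (* Expanding D c in [trA j] along [b] gives an integer relation among the [b l]. All its
       coefficients vanish, and the one at l = j is a sum of nonnegative integers. *)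
    have w0 : \sum_(c <- s) z c j * z c j * (\rank (E c))%:Z = 0.
      apply: (indep (fun l => \sum_(c <- s) z c j * z c l * (\rank (E c))%:Z)).
      under eq_bigr do rewrite rmorph_sum mulr_suml.
      rewrite exchange_big.
      apply: etrans (etrans (congr1 ( *%R D%:~R) (trA j)) (mulr0 _)).
      rewrite mulr_sumr big_seq [RHS]big_seq; apply: eq_bigr => c sc /=.
      rewrite mulrA mulrCA Dz ?mem_cat ?sc// mulr_sumr mulr_suml.
      by apply: eq_bigr => l _; rewrite !rmorphM /=; ring.
    have : z a j * z a j * (\rank (E a))%:Z = 0.
      apply/eqP; have := w0; rewrite (big_rem a)//= => /eqP.
      rewrite paddr_eq0; first by case/andP.
        by rewrite mulr_ge0// -expr2 sqr_ge0.
      by rewrite sumr_ge0// => c _; rewrite mulr_ge0// -expr2 sqr_ge0.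
    by move/eqP; rewrite !mulf_eq0 orbb eqz_nat (negPf ra) orbF => /eqP.
  have : D%:~R * a = 0 :> K.
    rewrite Dz ?mem_cat ?sa// big1// => j _; by rewrite za mul0r.
  move/eqP; rewrite mulf_eq0 => /orP[/eqP D0'|//].
  by case/eqP: D0; apply: intr_inj_char0; rewrite D0'.
rewrite -[A ^+ N]mulr1 -E1 mulr_sumr big_seq big1// => a sa.
have [a0|a0] := eqVneq a 0; last by rewrite E0// mulr0.
by have := nilE a sa; rewrite a0 raddf0 subr0.
Qed.

End TraceCriterion.

(** Nilpotency descends along the injection into a field where the characteristic polynomial splits.
    There [size s0] bounds all multiplicities, so one exponent serves for every eigenvalue. *)
Lemma nilpotent_of_trace (k : fieldType) (k0 : [pchar k] =i pred0) n'
    (A : 'M[k]_n'.+1) (I : finType) (Y Z : I -> 'M[k]_n'.+1) :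
  A = \sum_i (Y i * Z i - Z i * Y i) ->
  (forall i j, \tr (iter j (fun B => A * B - B * A) (Y i) * Z i) = 0) ->
  exists N, A ^+ N = 0.
Proof.
move=> AE tr0.
have [K [iota [s0 sP]]] := splitting_extension (monic_neq0 (char_poly_monic A)).
have K0 : [pchar K] =i pred0 by move=> p; rewrite (fmorph_pchar iota).
exists (size s0); apply: (map_mx_inj (f := iota)); rewrite map_mx0 rmorphXn /=.
apply: (nilpotent_of_trace_split K0 (undup_uniq s0)
  (Y := fun i => map_mx iota (Y i)) (Z := fun i => map_mx iota (Z i))).
- have : \prod_(a <- s0) ('X - a%:P) %|
      \prod_(a <- undup s0) ('X - a%:P) ^+ size s0.
    rewrite -big_undup_iterop_count /=.
    apply: (big_ind2 (fun p q => p %| q)) => // [p q p' q'|a _].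
      exact: dvdp_mul.
    by rewrite -/(_ ^+ _) dvdp_exp2l// count_size.
  rewrite -(eqp_dvdl _ sP) => /dvdpP[q ->]; rewrite rmorphM /=.
  by rewrite -map_horner_mx Cayley_Hamilton map_mx0 mulr0.
- rewrite [in LHS]AE raddf_sum; apply: eq_bigr => i _.
  by rewrite /= !(map_mxB, map_mxM).
move=> i j.
have -> : iter j (fun B => map_mx iota A * B - B * map_mx iota A)
    (map_mx iota (Y i)) = map_mx iota (iter j (fun B => A * B - B * A) (Y i)).
  by elim: j => //= j ->; rewrite -!rmorphM -rmorphB.
by rewrite -rmorphM /= trace_map_mx tr0 rmorph0.
Qed.

(** * Engel's theorem *)

Lemma exists_max_vspace (k : fieldType) (V : vectType k)
  (P : {vspace V} -> Prop)
    (U0 : {vspace V}) : P U0 ->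
  exists2 U, P U & forall U', P U' -> (\dim U' <= \dim U)%N.
Proof.
have [n] := ubnP (\dim {:V} - \dim U0); elim: n U0 => // n IH U0 /ltnSE U0n PU0.
have [[U [PU ltU]]|nP] := classic (exists U, P U /\ (\dim U0 < \dim U)%N).
  apply: IH PU; apply: leq_trans U0n.
  by rewrite ltn_sub2l// (leq_trans ltU)// dimvS// subvf.
by exists U0 => // U' PU'; rewrite leqNgt; apply/negP => ltU; apply: nP;
  exists U'.
Qed.

Section Engel.

Variables (k : fieldType) (n' : nat).
Local Notation gln := 'M[k]_n'.+1.
Implicit Types (x y t : gln) (T U W : {vspace gln}).

Definition ad_stable T U := forall t u, t \in T -> u \in U -> ad_mx t u \in U.
Definition nil_space T := forall t, t \in T -> exists N, t ^+ N = 0.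

Lemma ad_mx_jacobi x y z :
  ad_mx x (ad_mx y z) = ad_mx (ad_mx x y) z + ad_mx y (ad_mx x z).
Proof.
rewrite !ad_mxE !mulrBl !mulrBr !mulrA !opprB !addrA.
by rewrite [RHS](ACl (1*8*3*6*(5*2)*(7*4)))/= !subrr !addr0.
Qed.

Lemma ad_mxC x y : ad_mx x y = - ad_mx y x.
Proof. by rewrite !ad_mxE opprB. Qed.

(* Engel's theorem for the action of T on U/W. *)
Lemma engel_section T : ad_stable T T -> nil_space T ->
  forall W U, (W <= U)%VS -> W != U -> ad_stable T W -> ad_stable T U ->
  exists v, [/\ v \in U, v \notin W & forall t, t \in T -> ad_mx t v \in W].
Proof.
have [n] := ubnP (\dim T); elim: n T =>
  // n IH T /ltnSE Tn TT nilT W U WU neWU TW TU.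
have [T0|T0] := eqVneq T 0%VS.
  have /subvPn[v Uv W'v] : ~~ (U <= W)%VS.
    by apply: contra neWU => UW; rewrite eqEsubv WU.
  exists v; split=> // t; rewrite T0 memv0 => /eqP->.
  by rewrite ad_mxE mul0r mulr0 subrr mem0v.
have neT0 : 0%VS != T by rewrite eq_sym.
have stab0 : ad_stable 0%VS 0%VS.
  by move=> t u _; rewrite memv0 => /eqP->; rewrite linear0 mem0v.
have [H [HH HT neHT] maxH] := @exists_max_vspace _ _
  (fun H => [/\ ad_stable H H, (H <= T)%VS & H != T]) 0%VS
  (And3 stab0 (sub0v T) neT0).
have ltH : (\dim H < \dim T)%N.
  by rewrite ltn_neqAle dimvS// andbT; apply: contra neHT;
    rewrite eqEdim HT => /eqP->/=.
have nilH : nil_space H by move=> t /(subvP HT); exact: nilT.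
have stabH X : ad_stable T X -> ad_stable H X.
  by move=> TX t u /(subvP HT); exact: TX.
have IHH := IH H (leq_trans ltH Tn) HH nilH.
(* Induction for [H] acting on T/H: [x] normalizes [H], so H + <x> is a subalgebra, and the
   maximality of [H] makes it all of [T]. *)
have [x [Tx H'x Hx]] := IHH H T HT neHT HH (stabH _ TT).
have TE : (H + <[x]>)%VS = T.
  apply/eqP/negPn/negP => neT.
  have /negP[] : ~~ (\dim (H + <[x]>) <= \dim H)%N.
    rewrite -ltnNge ltn_neqAle dimvS ?addvSl// andbT; apply/negP => /eqP eqd.
    case/negP: H'x; rewrite memvE.
    have /eqP -> : H == (H + <[x]>)%VS by rewrite eqEdim addvSl -eqd/=.
    by rewrite addvSr.
  apply: maxH; split=> //; last by rewrite subv_add HT -memvE.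
  move=> _ _ /memv_addP[h Hh [_ /vlineP[a ->] ->]]
    /memv_addP[h' Hh' [_ /vlineP[b ->] ->]].
  apply: (subvP (addvSl _ _)); rewrite linearD /= linearZ /=.
  have addl u v w : ad_mx (u + v) w = ad_mx u w + ad_mx v w.
    by rewrite !ad_mxE mulrDl mulrDr opprD addrACA.
  have scall c v w : ad_mx (c *: v) w = c *: ad_mx v w.
    by rewrite !ad_mxE -scalerAl -scalerAr scalerBr.
  rewrite !addl !scall [ad_mx x x]ad_mxE subrr scaler0 addr0.
  rewrite rpredD ?rpredZ ?Hx// rpredD ?HH// rpredZ//.
  by rewrite (ad_mxC x) rpredN Hx.
have [v [Uv W'v Hv]] := IHH W U WU neWU (stabH _ TW) (stabH _ TU).
(* Since [x] normalizes [H], every iterate is still sent into [W] by [H]. As ad x is nilpotent, some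
   iterate is the last one outside [W], and [x] sends it into [W] too. *)
pose w j := iter j (ad_mx x) v.
have wP j : w j \in U /\ forall t, t \in H -> ad_mx t (w j) \in W.
  elim: j => [|j [IHU IHW]] //; split=> [|t Ht]; first exact: TU.
  rewrite [w _]/= ad_mx_jacobi rpredD//; last exact/TW/IHW.
  exact/IHW/Hx.
have [N xN] := nilT x Tx.
have wN : w (N + N)%N = 0.
  have -> : w (N + N)%N = iter (N + N) (fun B => x * B - B * x) v.
    by apply: eq_iter => B; exact: ad_mxE.
  by rewrite -ad_mx_exp; apply: amullr_exp_eq0; rewrite xN ?mul0r ?mulr0.
have [j wj wj1] : exists2 j, w j \notin W & w j.+1 \in W.
  have : w (N + N)%N \in W by rewrite wN mem0v.
  elim: (N + N)%N => [|j IHj] wj; first by case/negP: W'v.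
  by have [/IHj|] := boolP (w j \in W); last by exists j.
have [wU wH] := wP j; exists (w j); split=> // t.
rewrite -TE => /memv_addP[h Hh [_ /vlineP[a ->] ->]].
have -> : ad_mx (h + a *: x) (w j) = ad_mx h (w j) + a *: w j.+1.
  rewrite [w j.+1]/= !ad_mxE mulrDl mulrDr -scalerAl -scalerAr scalerBr.
  by rewrite opprD addrACA.
by rewrite rpredD//; [exact: wH|exact: rpredZ].
Qed.

(** If T were nonzero, Engel's theorem modulo a maximal proper ideal W would give T = W + <v> with
    [T, v] inside W. All brackets would then lie in W, contradicting perfectness, which is stated as
    a property of the subspaces containing the brackets. *)
Lemma nil_perfect_eq0 T : ad_stable T T -> nil_space T ->
  (forall W, (forall x y, x \in T -> y \in T -> ad_mx x y \in W) ->
    (T <= W)%VS) ->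
  T = 0%VS.
Proof.
move=> TT nilT perfT; apply/eqP/negPn/negP => T0.
have stab0 : ad_stable T 0%VS.
  by move=> t u _; rewrite memv0 => /eqP->; rewrite linear0 mem0v.
have neT0 : 0%VS != T by rewrite eq_sym.
have [W [TW WT neWT] maxW] := @exists_max_vspace _ _
  (fun W => [/\ ad_stable T W, (W <= T)%VS & W != T]) 0%VS
  (And3 stab0 (sub0v T) neT0).
have [v [Tv W'v Wv]] := engel_section TT nilT WT neWT TW TT.
have TE : (W + <[v]>)%VS = T.
  apply/eqP/negPn/negP => neT.
  have /negP[] : ~~ (\dim (W + <[v]>) <= \dim W)%N.
    rewrite -ltnNge ltn_neqAle dimvS ?addvSl// andbT; apply/negP => /eqP eqd.
    case/negP: W'v; rewrite memvE.
    have /eqP -> : W == (W + <[v]>)%VS by rewrite eqEdim addvSl -eqd/=.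
    by rewrite addvSr.
  apply: maxW; split=> //; last by rewrite subv_add WT -memvE.
  move=> t _ Tt /memv_addP[w Ww [_ /vlineP[a ->] ->]].
  apply: (subvP (addvSl _ _)); rewrite linearD /= linearZ /=.
  by rewrite rpredD//; [exact: TW|exact/rpredZ/Wv].
case/negP: neWT; rewrite eqEsubv WT; apply: perfT => x y Tx.
rewrite -TE => /memv_addP[w Ww [_ /vlineP[a ->] ->]].
by rewrite linearD linearZ /= rpredD//; [exact: TW|exact/rpredZ/Wv].
Qed.

End Engel.

(** * Ideals and trace forms *)

Section LieIdeals.

Variables (k : fieldType) (L : lieAlgType k).
Implicit Types (x y z : L) (A B J : {vspace L}).

Lemma lieDr x y z : lie x (y + z) = lie x y + lie x z.
Proof. exact: linearD. Qed.

Lemma lieZl a x y : lie (a *: x) y = a *: lie x y.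
Proof. by have := lie_linearl y a x 0; rewrite /= !addr0 lie0l addr0. Qed.

Lemma lieZr a x y : lie x (a *: y) = a *: lie x y.
Proof. exact: linearZ. Qed.

Lemma lie_jacobi_der x y z : lie x (lie y z) =
  lie (lie x y) z + lie y (lie x z).
Proof.
have := lie_jacobi x y z; rewrite (lieC z (lie x y)) (lieC z x) linearN /=.
by move/eqP; rewrite subr_eq0 => /eqP <-; rewrite subrK.
Qed.

Lemma is_idealP J : reflect (forall x y, y \in J -> lie x y \in J) (is_ideal J).
Proof.
apply: (iffP (lie_prodP _ _ _)) => JJ x y; last by move=> _; exact: JJ.
by apply: JJ; rewrite memvf.
Qed.

Lemma lie_prod_sum A B x : x \in lie_prod A B ->
  exists (I : finType) (u v : I -> L),
    [/\ forall i, u i \in A, forall i, v i \in B & x = \sum_i lie (u i) (v i)].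
Proof.
pose X := [seq lie u v | u <- vbasis A, v <- vbasis B].
move=> /(@coord_span _ _ _ (in_tuple X)) xE.
have ex (i : 'I_(size X)) : exists uv : L * L,
    [/\ uv.1 \in A, uv.2 \in B & X`_i = lie uv.1 uv.2].
  have /allpairsP[uv [uA vB ->]] := mem_nth 0 (ltn_ord i).
  by exists uv; rewrite !vbasis_mem.
have [uv uvP] := fin_all_exists ex.
exists 'I_(size X), (fun i => coord (in_tuple X) i x *: (uv i).1),
  (fun i => (uv i).2).
split=> [i|i|]; try by case: (uvP i) => ? ? _; rewrite ?rpredZ.
by rewrite xE; apply: eq_bigr => i _; rewrite lieZl; case: (uvP i) => _ _ <-;
  rewrite -xE.
Qed.

Lemma lie_prodS A A' B B' : (A <= A')%VS -> (B <= B')%VS ->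
  (lie_prod A B <= lie_prod A' B')%VS.
Proof.
move=> /subvP AA /subvP BB; apply/lie_prodP => x y /AA Ax /BB By.
exact: mem_lie_prod.
Qed.

Lemma ideal_cap A B : is_ideal A -> is_ideal B -> is_ideal (A :&: B)%VS.
Proof.
move=> /is_idealP AA /is_idealP BB; apply/is_idealP => x y.
by rewrite !memv_cap => /andP[Ay By]; rewrite AA ?BB.
Qed.

Lemma ideal_lie_prod A B : is_ideal A -> is_ideal B -> is_ideal (lie_prod A B).
Proof.
move=> /is_idealP AA /is_idealP BB; apply/is_idealP => x y.
move=> /lie_prod_sum[I [u [v [Au Bv ->]]]]; rewrite linear_sum /=.
apply: memv_suml => i _; rewrite lie_jacobi_der.
by rewrite rpredD ?mem_lie_prod ?AA ?BB.
Qed.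

Lemma lie_prod_subr A B : is_ideal B -> (lie_prod A B <= B)%VS.
Proof. by move=> /is_idealP BB; apply/lie_prodP => x y _; exact: BB. Qed.

Definition derived (i : nat) J := iter i (fun V => lie_prod V V) J.

Lemma ideal_derived i J : is_ideal J -> is_ideal (derived i J).
Proof. by move=> JJ; elim: i => //= i IH; exact: ideal_lie_prod. Qed.

Lemma derived_sub i J : is_ideal J -> (derived i J <= J)%VS.
Proof.
move=> JJ; elim: i => [|i IH]; first exact: subvv.
by apply: subv_trans IH; apply: lie_prod_subr; exact: ideal_derived.
Qed.

Lemma derived_stable J : is_ideal J -> exists i, derived i.+1 J = derived i J.
Proof.
move=> JJ; apply: NNPP => nst.
have dimD i : (\dim (derived i J) + i <= \dim J)%N.
  elim: i => [|i IH]; first by rewrite addn0.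
  rewrite addnS -addSn; apply: leq_trans IH; rewrite leq_add2r.
  have sub : (derived i.+1 J <= derived i J)%VS.
    by apply: lie_prod_subr; exact: ideal_derived.
  rewrite ltnNge; apply/negP => le; apply: nst; exists i.
  by apply/eqP; rewrite eqEdim sub.
by have := dimD (\dim J).+1; rewrite addnS ltnNge leq_addl.
Qed.

End LieIdeals.

Section TraceForm.

Variables (k : fieldType) (L : lieAlgType k) (n' : nat).
Variable rho : 'Hom(L, 'M[k]_n'.+1).
Hypothesis rho_lie : forall x y, rho (lie x y) = ad_mx (rho x) (rho y).
Implicit Types (x y z : L) (A B J : {vspace L}).

Definition trform x y : k := \tr (rho x * rho y).

Lemma trformC x y : trform x y = trform y x.
Proof. by rewrite /trform mxtrace_mulC. Qed.

Lemma trform_linear y : linear (trform^~ y : L -> k^o).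
Proof.
by move=> a u v; rewrite /trform linearP mulrDl -scalerAl raddfD /= mxtraceZ.
Qed.

Lemma trform_inv x y z : trform (lie x y) z = - trform y (lie x z).
Proof.
rewrite /trform !rho_lie !ad_mxE mulrBl mulrBr.
rewrite [LHS]raddfB [in RHS]raddfB /= opprB; congr (_ - _);
  last by rewrite mulrA.
by rewrite mulrA [RHS]mxtrace_mulC mulmxE mulrA.
Qed.

(** The stable term D of the derived series is perfect, so each [rho x] with x in D is a sum of
    commutators. The trace criterion makes it nilpotent, and a perfect algebra of nilpotent matrices
    is zero. *)
Lemma cartan_derived J : [pchar k] =i pred0 -> is_ideal J ->
  (forall x y, x \in J -> y \in J -> trform x y = 0) ->
  exists i, (derived i J <= lker rho)%VS.
Proof.
move=> k0 JJ trJ; have [i stD] := derived_stable JJ; exists i.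
set D := derived i J in stD *.
have DJ : {subset D <= J} by apply/subvP/derived_sub.
have DD : is_ideal D by exact: ideal_derived.
suff : (rho @: D)%VS = 0%VS by move/eqP; rewrite -lkerE.
have perfD x : x \in D -> exists (I : finType) (u v : I -> L),
    [/\ forall j, u j \in D, forall j, v j \in D & x = \sum_j lie (u j) (v j)].
  by move=> Dx; apply: lie_prod_sum;
    rewrite -[lie_prod D D]/(derived i.+1 J) stD.
apply: nil_perfect_eq0.
- move=> _ _ /memv_imgP[x Dx ->] /memv_imgP[y Dy ->].
  by rewrite -rho_lie memv_img// (is_idealP _ DD).
- move=> _ /memv_imgP[x Dx ->]; have [I [u [v [uD vD xE]]]] := perfD x Dx.
  apply: (nilpotent_of_trace k0 (Y := fun j => rho (u j)) (Z := fun j =>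
    rho (v j))).
    rewrite [in LHS]xE linear_sum; apply: eq_bigr => j _ /=.
    by rewrite rho_lie ad_mxE.
  move=> j l.
  have [w Jw ->] : exists2 w, w \in J &
      iter l (fun M => rho x * M - M * rho x) (rho (u j)) = rho w.
    elim: l => [|l [w Jw IH]]; first by exists (u j); rewrite ?DJ.
    exists (lie x w); first exact: (is_idealP _ JJ).
    by rewrite /= IH rho_lie ad_mxE.
  by apply: trJ => //; exact: DJ.
move=> W TW; apply/subvP => _ /memv_imgP[x /perfD[I [u [v [uD vD ->]]]] ->].
rewrite linear_sum memv_suml// => j _; rewrite /= rho_lie TW//; exact: memv_img.
Qed.

(** A kernel of a map into rows of length \dim A: when A meets its orthogonal trivially, that map is
    injective on A, hence onto by dimension. *)
Definition orth A : {vspace L} :=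
  lker (linfun (fun x => \row_(j < \dim A) trform x (vbasis A)`_j)).

Let orth_row_linear A :
  linear (fun x => \row_(j < \dim A) trform x (vbasis A)`_j).
Proof.
move=> a u v; apply/rowP => j; rewrite !mxE.
exact: (trform_linear _ a u v).
Qed.

Let orth_row A : {linear L -> 'rV[k]_(\dim A)} :=
  HB.pack (fun x => \row_(j < \dim A) trform x (vbasis A)`_j)
    (GRing.isLinear.Build k _ _ _ _ (orth_row_linear A)).

Lemma trform_suml (I : finType) (a : I -> k) (v : I -> L) y :
  trform (\sum_i a i *: v i) y = \sum_i a i * trform (v i) y.
Proof.
by rewrite /trform linear_sum mulr_suml raddf_sum; apply: eq_bigr => i _;
  rewrite linearZ /= -scalerAl mxtraceZ.
Qed.

Lemma trformBl x y z : trform (x - y) z = trform x z - trform y z.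
Proof. by rewrite /trform linearB mulrBl raddfB. Qed.

Lemma trformDl x y z : trform (x + y) z = trform x z + trform y z.
Proof. by rewrite /trform linearD mulrDl raddfD. Qed.

Lemma orthP A x : reflect (forall a, a \in A -> trform x a = 0) (x \in orth A).
Proof.
rewrite memv_ker (lfunE (orth_row A)) /=; apply: (iffP eqP) =>
  [/rowP xA a Aa|xA].
  rewrite trformC (coord_vbasis Aa) trform_suml big1// => i _.
  by have := xA i; rewrite !mxE trformC => ->; rewrite mulr0.
by apply/rowP => j; rewrite !mxE xA// vbasis_mem// memt_nth.
Qed.

Lemma ideal_orth A : is_ideal A -> is_ideal (orth A).
Proof.
move=> /is_idealP AA; apply/is_idealP => x y /orthP yA; apply/orthP => a Aa.
by rewrite trform_inv yA ?AA ?oppr0.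
Qed.

Lemma orth_decomp A : (A :&: orth A = 0)%VS ->
  forall x, exists2 a, a \in A & x - a \in orth A.
Proof.
move=> A0 x.
have dimA := limg_dim_eq A0.
have fA : (linfun (orth_row A) @: A = fullv)%VS.
  by apply/eqP; rewrite eqEdim subvf dimA dimvf /dim /= mul1n leqnn.
have : linfun (orth_row A) x \in (linfun (orth_row A) @: A)%VS.
  by rewrite fA memvf.
by case/memv_imgP=> a Aa xa; exists a; rewrite // memv_ker linearB /= xa subrr.
Qed.

(** The form is nondegenerate on a complement C of the kernel; [b] is a basis of C and [e] its dual
    basis. Elements of L are recovered only modulo the kernel, and [r] is the dimension of C. *)
Lemma trform_dual_bases : (orth fullv <= lker rho)%VS ->
  exists (r : nat) (b e : 'I_r -> L),
  [/\ forall x, rho x = \sum_i trform x (e i) *: rho (b i),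
      forall x, x - \sum_i trform x (b i) *: e i \in lker rho,
      \sum_i trform (b i) (e i) = r%:R
    & r = 0%N -> lker rho = fullv].
Proof.
set K := lker rho => radK; set C := (K^C)%VS.
have trK x y : x \in K -> trform x y = 0.
  by rewrite memv_ker /trform => /eqP->; rewrite mul0r raddf0.
have CK x : exists2 c, c \in C & x - c \in K.
  have /memv_addP[u Ku [c Cc ->]] :
    x \in (K + C)%VS by rewrite addv_complf memvf.
  by exists c; rewrite ?addrK.
have C0 : (C :&: orth C = 0)%VS.
  apply/eqP; rewrite -subv0; apply/subvP => x;
    rewrite memv_cap => /andP[Cx /orthP xC].
  rewrite -(capv_compl K) memv_cap Cx andbT; apply/(subvP radK)/orthP => y _.
  have [c Cc Kyc] := CK y; rewrite -(subrK c y) trformC trformDl trK//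
    add0r trformC xC//.
pose b (i : 'I_(\dim C)) := (vbasis C)`_i.
have bC i : b i \in C by rewrite vbasis_mem// memt_nth.
have fC : (linfun (orth_row C) @: C = fullv)%VS.
  by apply/eqP; rewrite eqEdim subvf (limg_dim_eq C0) dimvf /dim /= mul1n leqnn.
have ex i : exists e, e \in C /\ forall j, trform e (b j) = (i == j)%:R.
  have : delta_mx 0 i \in (linfun (orth_row C) @: C)%VS by rewrite fC memvf.
  case/memv_imgP=> e Ce eE; exists e; split=> // j.
  by have /rowP/(_ j) := eE; rewrite lfunE !mxE eqxx eq_sym.
have [e eP] := fin_all_exists ex.
have eb i j : trform (e i) (b j) = (i == j)%:R by case: (eP i).
have orthK x : (forall i, trform x (b i) = 0) -> x \in K.
  move=> xb; apply/(subvP radK)/orthP => y _.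
  have [c Cc Kyc] := CK y; rewrite -(subrK c y) trformC trformDl trK// add0r.
  rewrite (coord_vbasis Cc) trform_suml big1// => i _.
  by rewrite trformC xb mulr0.
have xbe x : x - \sum_i trform x (b i) *: e i \in K.
  apply: orthK => j; rewrite trformBl trform_suml (bigD1 j)//= eb eqxx mulr1.
  by rewrite big1 ?addr0 ?subrr// => i ij; rewrite eb (negPf ij) mulr0.
exists (\dim C), b, e; split=> //.
- move=> x; apply/eqP; rewrite -subr_eq0; under eq_bigr do rewrite -linearZ.
  rewrite -linear_sum -linearB /= -memv_ker.
  apply/(subvP radK)/orthP => y _.
  rewrite -(subrK (\sum_i trform y (b i) *: e i) y) trformC trformDl
    trK// add0r.
  rewrite trform_suml big1// => j _;
    rewrite [trform (e j) _]trformC trformBl trform_suml.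
  rewrite (bigD1 j)//= [trform (b j) _]trformC eb eqxx mulr1 big1 ?addr0
    ?subrr ?mulr0//.
  by move=> i ij; rewrite [trform (b i) _]trformC eb eq_sym (negPf ij) mulr0.
- under eq_bigr do rewrite trformC eb eqxx.
  by rewrite sumr_const card_ord.
move=> C00; apply/eqP; rewrite eqEsubv subvf/=; apply/subvP => x _.
by rewrite -[x]subr0; have := xbe x; rewrite big1// => i _;
  have : (i < 0)%N by rewrite -C00.
Qed.

End TraceForm.

(** * Complete reducibility *)

(** Write the characteristic polynomial as X^m q with q prime to X; a Bezout identity for X^(m+1)
    and q gives the projector. The extra factor X makes [e] a multiple of A even for m = 0.
    Polynomials are returned so that [e] and [A'] commute with whatever commutes with A. *)
Lemma fitting_mx (k : fieldType) n' (A : 'M[k]_n'.+1) :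
  exists p q : {poly k}, let e := horner_mx A p in let A' := horner_mx A q in
  [/\ e * e = e, e = A * A' & \tr (A * (1 - e)) = 0].
Proof.
have [m [q q0 pE]] := multiplicity_XsubC (char_poly A) 0.
rewrite subr0 monic_neq0 ?char_poly_monic//= in q0 pE.
have /Bezout_eq1_coprimepP[[u v] /= uv] : coprimep ('X^(m.+1)) q.
  by apply: coprimep_expl; rewrite coprimep_sym coprimepX.
have qX (p : {poly k}) : q * 'X^m %| p -> horner_mx A p = 0.
  by rewrite -pE => /dvdpP[r ->]; rewrite rmorphM /= Cayley_Hamilton mulr0.
exists (u * 'X^(m.+1)), (u * 'X^m) => /=.
have e1 : 1 - horner_mx A (u * 'X^(m.+1)) = horner_mx A (v * q).
  by rewrite -(rmorph1 (horner_mx A)) -rmorphB -uv addrC addKr.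
split.
- apply/eqP; rewrite -subr_eq0 -[X in _ - X]mulr1 -mulrBr
  -opprB mulrN oppr_eq0 e1.
  rewrite -rmorphM; apply/eqP/qX.
  have -> : u * 'X^(m.+1) * (v * q) = q * 'X^m * (u * v * 'X) by rewrite exprSr;
    ring.
  exact: dvdp_mulr.
- by rewrite exprS mulrCA rmorphM /= horner_mx_X.
apply: (@mxtrace_nilpotent _ _ _ m.+1).
have -> : A * (1 - horner_mx A (u * 'X^(m.+1))) = horner_mx A ('X * (v * q)).
  by rewrite e1 [RHS]rmorphM /= horner_mx_X.
rewrite -rmorphXn; apply: qX.
have -> : ('X * (v * q)) ^+ m.+1 = q * 'X^m * ('X * v * (v * q) ^+ m).
  by rewrite exprS exprMn; ring.
exact: dvdp_mulr.
Qed.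

(** * Matrices of a representation on an invariant subspace *)

Section InvariantCoordinates.

Variables (k : fieldType) (V : vectType k) (U : {vspace V}) (n' : nat).
Hypothesis dimU : \dim U = n'.+1.

Let b (i : 'I_n'.+1) := (vbasis U)`_i.

Definition sub_coord (v : V) : 'cV[k]_n'.+1 :=
  \col_i coord (vbasis U) (cast_ord (esym dimU) i) v.

Definition sub_mx (f : V -> V) : 'M[k]_n'.+1 :=
  \matrix_(i, j) coord (vbasis U) (cast_ord (esym dimU) i) (f (b j)).

Lemma sub_coord_linear : linear sub_coord.
Proof. by move=> a u v; apply/colP => i; rewrite !mxE linearP. Qed.

HB.instance Definition _ := GRing.isLinear.Build k V 'cV[k]_n'.+1 _ sub_coord
  sub_coord_linear.

Lemma sub_coordK u : u \in U -> u = \sum_i sub_coord u i 0 *: b i.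
Proof.
move=> /coord_vbasis {1}->.
rewrite (reindex (cast_ord (esym dimU))) /=; last first.
  by exists (cast_ord dimU) => i _; rewrite ?cast_ordK ?cast_ordKV.
by apply: eq_bigr => i _; rewrite !mxE.
Qed.

Lemma sub_coord_sum (w : 'cV[k]_n'.+1) : sub_coord (\sum_i w i 0 *: b i) = w.
Proof.
apply/colP => i; rewrite mxE linear_sum (bigD1 i)//= linearZ /=.
have coordb j : coord (vbasis U) (cast_ord (esym dimU) i) (b j) = (i == j)%:R.
  rewrite /b -[X in _`_X]/(nat_of_ord (cast_ord (esym dimU) j)).
  rewrite coord_free ?(basis_free (vbasisP U))//.
  by rewrite -val_eqE /= eq_sym.
rewrite coordb eqxx mulr1 big1 ?addr0// => j ij.
by rewrite linearZ /= coordb eq_sym (negPf ij) mulr0.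
Qed.

Lemma sub_coord_inj : {in U &, injective sub_coord}.
Proof. by move=> u v /sub_coordK{2}-> /sub_coordK{2}-> ->. Qed.

Lemma sub_basis_mem i : b i \in U.
Proof. by rewrite vbasis_mem// mem_nth// size_tuple dimU. Qed.

Lemma sub_mxE (f : 'End(V)) u : u \in U -> 
  sub_coord (f u) = sub_mx f *m sub_coord u.
Proof.
move=> Uu; apply/colP => i; rewrite mxE {1}(sub_coordK Uu) !linear_sum /=.
rewrite mxE; apply: eq_bigr => j _.
by rewrite !linearZ /= mulrC [sub_mx f i j]mxE.
Qed.

Lemma sub_mx_ext (f g : V -> V) : {in U, f =1 g} -> sub_mx f = sub_mx g.
Proof. by move=> fg; apply/matrixP => i j; rewrite !mxE fg ?sub_basis_mem. Qed.

Lemma sub_mx_linear a (f g : V -> V) :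
  sub_mx (fun x => a *: f x + g x) = a *: sub_mx f + sub_mx g.
Proof. by apply/matrixP => i j; rewrite !mxE linearP. Qed.

Lemma sub_mxM (f g : 'End(V)) : {in U, forall u, g u \in U} ->
  sub_mx (fun x => f (g x)) = sub_mx f * sub_mx g.
Proof.
move=> gU; suff E (w : 'cV_n'.+1) :
    sub_mx (f \o g)%VF *m w = sub_mx f * sub_mx g *m w.
  have -> : sub_mx (fun x => f (g x)) = sub_mx (f \o g)%VF.
    by apply: sub_mx_ext => x _; rewrite comp_lfunE.
  by apply/matrixP => i j; have /colP/(_ i) := E (delta_mx j 0);
    rewrite -!colE !mxE.
have [u Uu <-] : exists2 u, u \in U & sub_coord u = w.
  exists (\sum_i w i 0 *: b i); last exact: sub_coord_sum.
  by rewrite memv_suml// => i _; rewrite rpredZ ?sub_basis_mem.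
by rewrite -sub_mxE// comp_lfunE sub_mxE ?gU// sub_mxE// mulmxA.
Qed.

End InvariantCoordinates.

Section MatrixRepresentation.

Variables (k : fieldType) (L : lieAlgType k) (V : vectType k) (U : {vspace V}).
Variables (n' : nat) (tau : L -> 'End(V)).
Hypotheses (dimU : \dim U = n'.+1) (tau_linear : linear tau).
Hypothesis tauU : forall x u, u \in U -> tau x u \in U.
Hypothesis tau_lie : forall x y u, u \in U ->
  tau (lie x y) u = tau x (tau y u) - tau y (tau x u).

Definition rep_fun (x : L) := sub_mx dimU (tau x).

Lemma rep_mx_linear : linear rep_fun.
Proof.
move=> a x y; rewrite -sub_mx_linear; apply: sub_mx_ext => u _.
by rewrite tau_linear add_lfunE scale_lfunE.
Qed.

HB.instance Definition _ := GRing.isLinear.Build k L 'M[k]_n'.+1 _ rep_fun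
  rep_mx_linear.

Definition rep_mx : 'Hom(L, 'M[k]_n'.+1) := linfun rep_fun.

Lemma rep_mxE x : rep_mx x = sub_mx dimU (tau x).
Proof. by rewrite lfunE. Qed.

Lemma rep_mx_lie x y : rep_mx (lie x y) = ad_mx (rep_mx x) (rep_mx y).
Proof.
rewrite ad_mxE !rep_mxE -!sub_mxM; do ?by move=> u; exact: tauU.
rewrite addrC -scaleN1r -sub_mx_linear; apply: sub_mx_ext => u Uu.
by rewrite tau_lie// scaleN1r addrC.
Qed.

Lemma rep_mx_coord x u : u \in U ->
  sub_coord dimU (tau x u) = rep_mx x *m sub_coord dimU u.
Proof. by move=> Uu; rewrite rep_mxE sub_mxE. Qed.

Lemma rep_mx_ker x u : x \in lker rep_mx -> u \in U -> tau x u = 0.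
Proof.
rewrite memv_ker => /eqP x0 Uu; apply: (sub_coord_inj (dimU := dimU)).
- exact: tauU.
- exact: mem0v.
by rewrite linear0 rep_mx_coord// x0 mul0mx.
Qed.

End MatrixRepresentation.

Section Semisimple.

Variables (k : fieldType) (L : lieAlgType k).
Hypotheses (k0 : [pchar k] =i pred0) (ss : semisimple L).
Implicit Types (x y z : L) (A B J : {vspace L}).

(* The Killing form is nondegenerate on A, so that B splits as the sum of A
   and of the abelian ideal B :&: orth A. *)
Lemma semisimple_abelian_quotient A B : is_ideal A -> is_ideal B ->
  (A <= B)%VS -> (lie_prod B B <= A)%VS -> (B <= A)%VS.
Proof.
move=> idA idB AB BBA; case dimL: (\dim {:L}) => [|n'].
  suff -> : B = 0%VS by exact: sub0v.
  by apply/eqP; rewrite -dimv_eq0 -leqn0 -dimL dimvS// subvf.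
pose tau x : 'End(L) := linfun (lie x).
have tau_linear : linear tau.
  by move=> a x y; apply/lfunP => z; rewrite !lfun_simp /= lieDl lieZl.
have tau_lie x y u : u \in {:L}%VS ->
  tau (lie x y) u = tau x (tau y u) - tau y (tau x u).
  by move=> _; rewrite !lfunE /= lie_jacobi_der addrK.
have tauU x (u : L) : u \in {:L}%VS -> tau x u \in {:L}%VS.
  by move=> _; exact: memvf.
pose rho := rep_mx tau dimL.
have rho_lie := rep_mx_lie dimL tau_linear tauU tau_lie.
have kerC x z : x \in lker rho -> lie x z = 0.
  by move=> x0; have := rep_mx_ker tau_linear tauU x0 (memvf z); rewrite lfunE.
have A0 : (A :&: orth rho A)%VS = 0%VS.
  have idJ : is_ideal (A :&: orth rho A)%VS.
    by apply: ideal_cap => //; exact: ideal_orth.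
  apply: (ss idJ).
  have [|i Di] := cartan_derived rho_lie k0 idJ.
    move=> x y; rewrite !memv_cap => /andP[_ /orthP xA] /andP[Ay _]; exact: xA.
  exists i.+1; apply/eqP; rewrite -subv0;
    apply/lie_prodP => x y /(subvP Di) x0 _.
  by rewrite memv0 kerC.
have C0 : (B :&: orth rho A)%VS = 0%VS.
  have idJ : is_ideal (B :&: orth rho A)%VS.
    by apply: ideal_cap => //; exact: ideal_orth.
  apply: (ss idJ); exists 1%N; apply/eqP; rewrite -subv0 -A0 subv_cap.
  rewrite (subv_trans (lie_prodS (capvSl _ _) (capvSl _ _)) BBA)/=.
  by rewrite (subv_trans (lie_prod_subr _ idJ))// capvSr.
apply/subvP => x Bx; have [a Aa xaA] := orth_decomp A0 x.
suff /eqP : x - a = 0 by rewrite subr_eq0 => /eqP->.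
by apply/eqP; rewrite -memv0 -C0 memv_cap xaA rpredB// (subvP AB).
Qed.

Lemma semisimple_ideal_perfect A : is_ideal A -> (A <= lie_prod A A)%VS.
Proof.
move=> idA; apply: semisimple_abelian_quotient => //;
  first exact: ideal_lie_prod.
exact: lie_prod_subr.
Qed.

Lemma semisimple_ideal_derived A i : is_ideal A -> (A <= derived i A)%VS.
Proof.
move=> idA; elim: i => [|i IH]; first exact: subvv.
apply: (subv_trans IH); apply: semisimple_ideal_perfect; exact: ideal_derived.
Qed.

End Semisimple.

(** * Vanishing of first cohomology *)

Section Whitehead.

Variables (k : fieldType) (L : lieAlgType k).
Hypotheses (k0 : [pchar k] =i pred0) (ss : semisimple L).
Variable n' : nat.
Implicit Types (x y z : L) (rho : 'Hom(L, 'M[k]_n'.+1)).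

(* The invariance of the Casimir tensor \sum_i b i (x) e i. *)
Lemma casimir_invariant rho r (b e : 'I_r -> L)
  p (F : 'Hom(L, 'M[k]_(n'.+1, p))) :
  (forall x y, rho (lie x y) = ad_mx (rho x) (rho y)) ->
  (forall x, rho x = \sum_i trform rho x (e i) *: rho (b i)) ->
  (forall x, x - \sum_i trform rho x (b i) *: e i \in lker rho) ->
  (lker rho <= lker F)%VS ->
  forall x, \sum_i rho (lie x (b i)) *m F (e i) =
    - \sum_i rho (b i) *m F (lie x (e i)).
Proof.
move=> rho_lie rhoE eE /subvP kerF x.
have FE y : F y = \sum_i trform rho y (b i) *: F (e i).
  have /kerF := eE y; rewrite memv_ker linearB subr_eq0 linear_sum => /eqP->.
  by apply: eq_bigr => i _; rewrite linearZ.
transitivity (\sum_i \sum_j trform rho (lie x (b i)) (e j) *: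
  (rho (b j) *m F (e i))).
  apply: eq_bigr => i _; rewrite rhoE mulmx_suml; apply: eq_bigr => j _.
  by rewrite -scalemxAl.
rewrite exchange_big -sumrN; apply: eq_bigr => j _.
rewrite FE mulmx_sumr -sumrN; apply: eq_bigr => i _.
by rewrite -scalemxAr -scaleNr trform_inv// [trform rho (b i) _]trformC.
Qed.

(* By induction on the rank of P. The Casimir element c of the module im P has
   trace r <> 0, hence a nonzero Fitting projector e, on which c is invertible
   with inverse c'. There f is the coboundary of c' u0, since
   rho x u0 = c (f x); what is left takes its values in im (P - e). *)
Lemma whitehead_mx rho (P : 'M[k]_n'.+1) (f : 'Hom(L, 'cV[k]_n'.+1)) :
  (forall x y, rho (lie x y) = ad_mx (rho x) (rho y)) ->
  P * P = P -> (forall x, GRing.comm (rho x) P) ->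
  (forall x y, f (lie x y) = rho x *m f y - rho y *m f x) ->
  (forall x, P *m f x = f x) ->
  exists u, forall x, f x = rho x *m u.
Proof.
move=> rho_lie; have [n] := ubnP (\rank P).
elim: n P f => // n IH P f /ltnSE rP PP rhoP f_lie Pf.
(* The module im P, extended by zero on the kernel of P: its trace form is computed without changing
   the matrix size. *)
pose rho' : 'Hom(L, 'M[k]_n'.+1) := (amulr P \o rho)%VF.
have rho'E x : rho' x = rho x * P by rewrite comp_lfunE lfunE.
have rho'_lie x y : rho' (lie x y) = ad_mx (rho' x) (rho' y).
  rewrite !rho'E rho_lie !ad_mxE mulrBl -!mulrA.
  by rewrite (mulrA P (rho y)) -(rhoP y) -(mulrA _ P) PP
    (mulrA P (rho x)) -(rhoP x) -(mulrA _ P) PP.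
have rho'f x y : rho' x *m f y = rho x *m f y.
  by rewrite rho'E -[in RHS]Pf mulmxA.
have idK : is_ideal (lker rho').
  apply/is_idealP => x y; rewrite !memv_ker rho'_lie => /eqP->.
  by rewrite linear0.
have radK : (orth rho' fullv <= lker rho')%VS.
  have idR : is_ideal (orth rho' fullv).
    by apply: ideal_orth => //; apply/is_idealP => x y _; exact: memvf.
  have [|i Ri] := cartan_derived rho'_lie k0 idR.
    by move=> x y /orthP xR _; rewrite xR ?memvf.
  exact: subv_trans (semisimple_ideal_derived k0 ss i idR) Ri.
(* The kernel is an ideal, hence perfect, and the cocycle identity kills [f] on brackets of its
   elements. So [f] may be evaluated modulo the kernel, as the Casimir identities require. *)
have fK : (lker rho' <= lker f)%VS.
  apply: subv_trans (semisimple_ideal_perfect k0 ss idK) _.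
  apply/lie_prodP => x y; rewrite !memv_ker => /eqP x0 /eqP y0.
  by rewrite f_lie -!rho'f x0 y0 !mul0mx subrr.
have [r [b [e [rhoE eE trbe r0]]]] := trform_dual_bases radK.
have [rz|r_neq0] := eqVneq r 0%N.
  exists 0 => x; rewrite mulmx0; apply/eqP; rewrite -memv_ker.
  by apply: (subvP fK); rewrite r0 ?memvf.
pose c := \sum_i rho' (b i) * rho' (e i).
pose u0 := \sum_i rho' (b i) *m f (e i).
have Prho' x : P * rho' x = rho' x by rewrite rho'E mulrA -(rhoP x) -mulrA PP.
have rho'P x : rho' x * P = rho' x by rewrite rho'E -mulrA PP.
have rhorho' x y : rho x * rho' y = rho' x * rho' y.
  by rewrite [rho' x]rho'E -mulrA Prho'.
(* Moving [rho x] through each term leaves the two sums of [casimir_invariant] for F = f, which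
   cancel. The same with F = rho' shows that [c] is central. *)
have cu0 x : rho x *m u0 = c *m f x.
  rewrite /u0 /c mulmx_sumr mulmx_suml.
  have E i : rho x *m (rho' (b i) *m f (e i)) = rho' (lie x (b i)) *m f (e i)
      + rho' (b i) *m f (lie x (e i)) + rho' (b i) * rho' (e i) *m f x.
    rewrite f_lie -!rho'f rho'_lie ad_mxE mulmxBl mulmxBr.
    have -> : rho x *m (rho' (b i) *m f (e i)) = rho' x * rho' (b i) *m f (e i).
      by rewrite mulmxA -rhorho'.
    by rewrite !mulmxA addrA !subrK.
  under eq_bigr do rewrite E.
  rewrite !big_split /= (casimir_invariant rho'_lie rhoE eE fK).
  by rewrite addNr add0r.
have c_rho' x : GRing.comm (rho' x) c.
  rewrite /GRing.comm /c mulr_sumr mulr_suml.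
  have E i : rho' x * (rho' (b i) * rho' (e i)) =
    rho' (lie x (b i)) *m rho' (e i)
      + rho' (b i) *m rho' (lie x (e i)) + rho' (b i) * rho' (e i) * rho' x.
    by rewrite !mulmxE !rho'_lie !ad_mxE mulrBl mulrBr !mulrA addrA !subrK.
  under eq_bigr do rewrite E.
  rewrite !big_split /= (casimir_invariant rho'_lie rhoE eE (subvv _)).
  by rewrite addNr add0r.
have cP : c * P = c.
  by rewrite mulr_suml; apply: eq_bigr => i _; rewrite -mulrA rho'P.
have Pc : P * c = c.
  by rewrite mulr_sumr; apply: eq_bigr => i _; rewrite mulrA Prho'.
have c_rho x : GRing.comm (rho x) c.
  by rewrite /GRing.comm -{1}Pc mulrA -rho'E c_rho' -{2}cP -[RHS]mulrA
    -(rhoP x) -rho'E.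
have trc : \tr c != 0.
  have -> : \tr c = r%:R by rewrite -trbe raddf_sum.
  by rewrite ((@pcharf0P k).1 k0).
have [p [q [ee eE' trce]]] := fitting_mx c.
set e' := horner_mx c p in ee eE' trce; set c' := horner_mx c q in eE'.
have cc' : GRing.comm c c' by apply: comm_mx_horner.
have Pe : P * e' = e' by rewrite eE' mulrA Pc.
have eP : e' * P = e' by rewrite eE' cc' -mulrA cP.
have e_neq0 : e' != 0.
  apply: contraNneq trc => e0; move: trce; rewrite e0 subr0 mulr1 => ->.
  exact: eqxx.
have PeP : (P - e') * (P - e') = P - e'.
  by rewrite mulrBl !mulrBr PP Pe eP ee subrr subr0.
have e_rho x : GRing.comm (rho x) e' by exact/comm_mx_horner/c_rho.
pose f' : 'Hom(L, 'cV[k]_n'.+1) :=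
  f - ((linfun (mulmx e') : 'Hom('cV[k]_n'.+1, 'cV[k]_n'.+1)) \o f)%VF.
have f'E x : f' x = f x - e' *m f x.
  by rewrite add_lfunE opp_lfunE comp_lfunE [linfun _ _]lfunE.
have [|||||u' fu'] := IH (P - e') f'.
- apply: leq_trans rP.
  (* Ranks of idempotents are traces, so in characteristic zero they add up, and removing [e']
     lowers the rank. *)
  have natI : injective (fun i : nat => i%:R : k).
    move=> i j ij; apply/eqP; rewrite -eqz_nat; apply/eqP.
    by apply: (intr_inj_char0 k0); rewrite /= -!pmulrn.
  have rankP : \rank P = (\rank (P - e')%R + \rank e')%N.
    apply: natI; rewrite /= natrD -(mxtrace_idempotent PP)
      -(mxtrace_idempotent PeP).
    by rewrite -(mxtrace_idempotent ee) -raddfD subrK.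
  by rewrite rankP -addn1 leq_add2l lt0n mxrank_eq0.
- exact: PeP.
- by move=> x; apply: commrB.
- move=> x y; rewrite !f'E f_lie !mulmxBr !mulmxA.
  have {}e_rho z : e' *m rho z = rho z *m e' by apply/esym/e_rho.
  by rewrite !e_rho !opprB addrACA [RHS]addrACA; congr (_ + _); rewrite addrC.
- move=> x; rewrite f'E mulmxBl !mulmxBr !mulmxA Pf.
  have -> : P *m e' = e' by exact: Pe.
  have -> : e' *m e' = e' by exact: ee.
  by rewrite subrr subr0.
exists (u' + c' *m u0) => x; rewrite mulmxDr -fu' f'E.
rewrite mulmxA; have -> : rho x *m c' = c' *m rho x by apply: comm_mx_horner;
  exact: c_rho.
rewrite -mulmxA cu0 mulmxA. have -> : c' *m c = e' by rewrite mulmxE eE' cc'.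
by rewrite subrK.
Qed.

End Whitehead.

Section CompleteReducibility.

Variables (k : fieldType) (L : lieAlgType k).
Hypotheses (k0 : [pchar k] =i pred0) (ss : semisimple L).

(** The map sending x to [tau x v] is a cocycle with values in U; an element [u] of which it is the
    coboundary is the correction to [v]. *)
Lemma semisimple_invariant_lift (V : vectType k) (U : {vspace V})
    (tau : L -> 'End(V)) (v : V) :
  linear tau ->
  (forall x y, tau (lie x y) = ((tau x \o tau y) - (tau y \o tau x))%VF) ->
  (forall x u, u \in U -> tau x u \in U) ->
  (forall x, tau x v \in U) ->
  exists2 u, u \in U & forall x, tau x (v - u) = 0.
Proof.
move=> tau_lin tau_lie tauU tauv.
have tau_lieE x y u : tau (lie x y) u = tau x (tau y u) - tau y (tau x u).
  by rewrite tau_lie add_lfunE opp_lfunE !comp_lfunE.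
case dimU: (\dim U) => [|n'].
  exists 0; rewrite ?mem0v// => x; rewrite subr0; apply/eqP; rewrite -memv0.
  by have /eqP <- : U == 0%VS by rewrite -dimv_eq0 dimU.
pose rho := rep_mx tau dimU.
have rho_lie := rep_mx_lie dimU tau_lin tauU (fun x y u _ => tau_lieE x y u).
have f_lin : linear (fun x => sub_coord dimU (tau x v)).
  by move=> a x y; rewrite tau_lin add_lfunE scale_lfunE linearP.
pose f : {linear L -> 'cV[k]_n'.+1} :=
  HB.pack (fun x => sub_coord dimU (tau x v))
  (GRing.isLinear.Build k _ _ _ _ f_lin).
have [||||w fw] := whitehead_mx (P := 1) (f := linfun f) k0 ss rho_lie.
- exact: mulr1.
- by move=> x; exact: commr1.
- move=> x y; rewrite !(lfunE f) /= tau_lieE linearB /=.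
  by congr (_ - _); apply: rep_mx_coord.
- by move=> x; exact: mul1mx.
pose u := \sum_i w i 0 *: (vbasis U)`_i.
have Uu : u \in U.
  by rewrite memv_suml// => i _; rewrite rpredZ// (sub_basis_mem dimU i).
exists u => // x; rewrite linearB; apply/eqP; rewrite subr_eq0; apply/eqP.
apply: (sub_coord_inj (dimU := dimU)) (tauv x) (tauU x u Uu) _.
rewrite [RHS]rep_mx_coord// [sub_coord dimU u]sub_coord_sum -fw.
by rewrite (lfunE f).
Qed.

(** L acts on Hom(M, N) by commutators, and equivariant maps are the invariants. A linear section of
    [phi] is invariant modulo the submodule of maps killed by [phi]; correcting it inside that
    submodule keeps it a section. *)
Lemma semisimple_equivariant_section (N M : vectType k) (sigma : L -> 'End(N))
    (delta : L -> 'End(M)) (phi : 'Hom(N, M)) :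
  linear sigma -> linear delta ->
  (forall x y, sigma (lie x y) =
    ((sigma x \o sigma y) - (sigma y \o sigma x))%VF) ->
  (forall x y, delta (lie x y) =
    ((delta x \o delta y) - (delta y \o delta x))%VF) ->
  limg phi = fullv -> (forall x v, phi (sigma x v) = delta x (phi v)) ->
  exists s : 'Hom(M, N), cancel s phi /\ forall x v, sigma x (s v) =
    s (delta x v).
Proof.
move=> sig_lin del_lin sig_lie del_lie phi_surj phi_eq.
pose t x (h : 'Hom(M, N)) := ((sigma x \o h) - (h \o delta x))%VF.
have t_lin x : linear (t x).
  move=> a g h; rewrite /t; apply/lfunP => v; rewrite !lfun_simp linearP /=.
  by rewrite scalerBr opprD addrACA.
pose tl x : {linear 'Hom(M, N) -> 'Hom(M, N)} :=
  HB.pack (t x) (GRing.isLinear.Build k _ _ _ _ (t_lin x)).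
pose tau x := linfun (tl x).
have tauE x h v : tau x h v = sigma x (h v) - h (delta x v).
  by rewrite lfunE /= /t !lfun_simp.
have post_lin : linear (fun h : 'Hom(M, N) => (phi \o h)%VF).
  by move=> a g h; rewrite comp_lfunDr comp_lfunZr.
pose post : {linear 'Hom(M, N) -> 'End(M)} :=
  HB.pack (fun h : 'Hom(M, N) => (phi \o h)%VF)
    (GRing.isLinear.Build k _ _ _ _ post_lin).
pose U := lker (linfun post).
have UP h : (h \in U) = ((phi \o h)%VF == 0) by rewrite memv_ker lfunE.
have phiK : cancel phi^-1%VF phi.
  by move=> v; rewrite limg_lfunVK// phi_surj memvf.
have [||||u] := semisimple_invariant_lift (U := U) (tau := tau) (v :=
  phi^-1%VF).
- move=> a x y; apply/lfunP => h; apply/lfunP => v.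
  rewrite !lfun_simp /= /t sig_lin del_lin !lfun_simp linearP /=.
  by rewrite scalerBr opprD addrACA.
- move=> x y; apply/lfunP => h; apply/lfunP => v.
  rewrite !(add_lfunE, opp_lfunE, comp_lfunE) !tauE sig_lie del_lie.
  rewrite !(add_lfunE, opp_lfunE, comp_lfunE) !linearB /=.
  by rewrite !opprK !addrA [RHS](ACl (1*5*8*4*(7*2)*(6*3)))/= !subrr !addr0.
- move=> x h; rewrite !UP => /eqP ph0; apply/eqP/lfunP => v.
  have ph w : phi (h w) = 0 by rewrite -comp_lfunE ph0 zero_lfunE.
  by rewrite zero_lfunE comp_lfunE tauE linearB /= phi_eq !ph linear0 subrr.
- move=> x; rewrite UP; apply/eqP/lfunP => v.
  by rewrite zero_lfunE comp_lfunE tauE linearB /= phi_eq !phiK subrr.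
rewrite UP => /eqP pu tau0; exists (phi^-1%VF - u); split=> [v|x v].
  rewrite add_lfunE opp_lfunE linearB /= phiK -[X in _ - X]comp_lfunE pu.
  by rewrite zero_lfunE subr0.
by apply/eqP; rewrite -subr_eq0 -tauE tau0 zero_lfunE.
Qed.

End CompleteReducibility.

(** * Presentations of nilpotent Lie algebras *)

Section LowerCentral.

Variables (k : fieldType) (L : lieAlgType k).
Implicit Types (x y z : L) (X : {vspace L}).

Lemma lower_centralS j : lower_central L j.+2 =
  lie_prod fullv (lower_central L j.+1).
Proof. by []. Qed.

Lemma ideal_fullv : is_ideal (fullv : {vspace L}).
Proof. exact: subvf. Qed.

Lemma ideal_lower_central j : is_ideal (lower_central L j.+1).
Proof.
elim: j => [|j IH]; first exact: ideal_fullv.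
by rewrite lower_centralS; apply: ideal_lie_prod => //; exact: ideal_fullv.
Qed.

Lemma nilpotent_solvable t : lower_central L t.+1 = 0%VS -> solvable L.
Proof.
move=> Lt; exists t; apply/eqP; rewrite -subv0 -Lt.
elim: (t) => [|i IH]; first exact: subvv.
by rewrite lower_centralS; apply: lie_prodS => //; exact: subvf.
Qed.

(** If L = X + L^j, expanding a bracket gives an element of X plus terms with a factor in L^j, so
    [L, L] lies in X + L^(j+1). Iterate until L^j vanishes. *)
Lemma nilpotent_generation t X : lower_central L t.+1 = 0%VS ->
  is_subalgebra X -> (X + lower_central L 2)%VS = fullv -> X = fullv.
Proof.
move=> Lt /lie_prodP XX X2.
have XL j : (X + lower_central L j.+1)%VS = fullv.
  elim: j => [|j IH]; first by apply/eqP; rewrite eqEsubv subvf addvSr.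
  apply/eqP; rewrite eqEsubv subvf -[X in (X <= _)%VS]X2 subv_add addvSl/=.
  apply/lie_prodP => x y _ _.
  have /memv_addP[a Xa [b Lb ->]] : x \in (X + lower_central L j.+1)%VS.
    by rewrite IH memvf.
  have /memv_addP[c Xc [d Ld ->]] : y \in (X + lower_central L j.+1)%VS.
    by rewrite IH memvf.
  rewrite lieDr !lieDl -addrA memv_add ?XX// lower_centralS.
  rewrite rpredD//; first by rewrite lieC rpredN mem_lie_prod ?memvf.
  by rewrite rpredD// mem_lie_prod ?memvf.
by rewrite -[LHS]addv0 -Lt XL.
Qed.

End LowerCentral.

Section Homomorphisms.

Variables (k : fieldType) (L1 L2 : lieAlgType k) (f : 'Hom(L1, L2)).
Hypothesis f_lie : is_lie_hom f.

Lemma limg_lie_prod (U V : {vspace L1}) :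
  (f @: lie_prod U V)%VS = lie_prod (f @: U) (f @: V).
Proof.
apply/eqP; rewrite eqEsubv; apply/andP; split.
  apply/subvP => _ /memv_imgP[x /lie_prod_sum[I [u [v [Uu Vv ->]]]] ->].
  rewrite linear_sum memv_suml// => i _.
  by rewrite /= f_lie mem_lie_prod ?memv_img.
apply/lie_prodP => _ _ /memv_imgP[x Ux ->] /memv_imgP[y Vy ->].
by rewrite -f_lie memv_img ?mem_lie_prod.
Qed.

Lemma limg_lower_central j : limg f = fullv ->
  (f @: lower_central L1 j.+1)%VS = lower_central L2 j.+1.
Proof.
move=> f_surj; elim: j => [|j IH]; first exact: f_surj.
by rewrite !lower_centralS limg_lie_prod IH f_surj.
Qed.

Lemma limg_lower_central_sub j :
  (f @: lower_central L1 j.+1 <= lower_central L2 j.+1)%VS.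
Proof.
elim: j => [|j IH]; first exact: subvf.
by rewrite !lower_centralS limg_lie_prod lie_prodS ?subvf.
Qed.

Lemma limg_subalgebra : is_subalgebra (limg f).
Proof. by rewrite /is_subalgebra -limg_lie_prod limgS ?subvf. Qed.

End Homomorphisms.

(** Trades the quotient, whose carrier is a chosen complement, for a surjection with prescribed
    kernel. *)
Lemma lie_isomorphic_quotP (k : fieldType) (F N : lieAlgType k) (I : ideal F) :
  lie_isomorphic N (quot_lie I) <->
  exists Phi : 'Hom(F, N),
    [/\ is_lie_hom Phi, limg Phi = fullv & lker Phi = I].
Proof.
split=> [[g [g_lie g0 g_surj]]|[Phi [Phi_lie Phi_surj kerPhi]]].
  have gK : cancel g^-1%VF g.
    by move=> y; rewrite limg_lfunVK// g_surj memvf.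
  have g_inj : injective g by apply/lker0P/eqP.
  exists (g^-1 \o quot_proj I)%VF.
  have gPhi p : g ((g^-1 \o quot_proj I)%VF p) = quot_proj I p.
    by rewrite comp_lfunE gK.
  split.
  - by move=> p q; apply: g_inj; rewrite g_lie !gPhi quot_proj_hom.
  - apply/eqP; rewrite eqEsubv subvf; apply/subvP => y _.
    have : g y \in limg (quot_proj I) by rewrite limg_quot_proj memvf.
    case/memv_imgP=> p _ gy; apply/memv_imgP; exists p; rewrite ?memvf//.
    by apply: g_inj; rewrite gPhi.
  apply/vspaceP => p; rewrite memv_ker -quot_proj_eq0 -gPhi.
  by apply/eqP/eqP => [->|gp]; [rewrite linear0 | apply: g_inj;
    rewrite gp linear0].
have PhiK : cancel Phi^-1%VF Phi.
  by move=> y; rewrite limg_lfunVK// Phi_surj memvf.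
pose g := (quot_proj I \o Phi^-1)%VF.
have gE p : g (Phi p) = quot_proj I p.
  rewrite comp_lfunE; apply: quot_projP.
  by rewrite -kerPhi memv_ker linearB /= PhiK subrr.
have surj y : exists p, y = Phi p by exists (Phi^-1%VF y); rewrite PhiK.
exists g; split.
- move=> x y; have [p ->] := surj x; have [q ->] := surj y.
  by rewrite -Phi_lie !gE quot_proj_hom.
- apply/eqP; rewrite -subv0; apply/subvP => y; have [p ->] := surj y.
  by rewrite memv_ker gE quot_proj_eq0 -kerPhi memv_ker memv0.
apply/eqP; rewrite eqEsubv subvf; apply/subvP => z _.
have : z \in limg (quot_proj I) by rewrite limg_quot_proj memvf.
by case/memv_imgP=> p _ ->; rewrite -gE memv_img ?memvf.
Qed.

(** * Nilpotent algebras generated by a copy of m, covering both models *)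

Section GeneratedLie.

Variables (k : fieldType) (m : vectType k) (F : lieAlgType k) (t : nat).
Variables (iota : m -> F) (pi : 'Hom(F, m)).
Hypotheses (iotaK : cancel iota pi) (ker_pi : lker pi = lower_central F 2).
Hypothesis nilF : lower_central F t.+1 = 0%VS.

Lemma generated_closed (X : {vspace F}) :
  is_subalgebra X -> (forall x, iota x \in X) -> X = fullv.
Proof.
move=> XX iX; apply: nilpotent_generation nilF XX _.
apply/eqP; rewrite eqEsubv subvf; apply/subvP => p _.
rewrite -(subrK (iota (pi p)) p) addrC memv_add// -ker_pi memv_ker.
by rewrite linearB /= iotaK subrr.
Qed.

(** The elements on which both sides agree form a subalgebra, and it contains the generators. *)
Lemma derivation_intertwine (N : lieAlgType k) (Phi : 'Hom(F, N))
    (D : 'End(F)) (D' : 'End(N)) :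
  is_lie_hom Phi -> is_derivation D -> is_derivation D' ->
  (forall x, Phi (D (iota x)) = D' (Phi (iota x))) ->
  forall p, Phi (D p) = D' (Phi p).
Proof.
move=> PhiL DD DD' Di.
pose X := lker ((Phi \o D) - (D' \o Phi))%VF.
have XP p : reflect (Phi (D p) = D' (Phi p)) (p \in X).
  rewrite memv_ker add_lfunE opp_lfunE !comp_lfunE subr_eq0; exact: eqP.
suff XE : X = fullv by move=> p; apply/XP; rewrite XE memvf.
apply: generated_closed => [|x]; last exact/XP.
apply/lie_prodP => p q /XP pX /XP qX; apply/XP.
by rewrite DD PhiL DD' linearD /= !PhiL pX qX.
Qed.

Lemma extension_unique delta (D D' : 'End(F)) :
  is_extension iota delta D -> is_extension iota delta D' -> D = D'.
Proof.
move=> [DD Di] [DD' Di']; apply/lfunP => p.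
have idL : is_lie_hom (\1%VF : 'End(F)) by move=> x y; rewrite !id_lfunE.
have := derivation_intertwine idL DD DD'; rewrite /= => E.
have {}E := E _ p; rewrite !id_lfunE in E; apply: E => x.
by rewrite !id_lfunE Di Di'.
Qed.

Section Extensions.

Variable ext : 'End(m) -> 'End(F).
Hypothesis ext_ext : forall delta, is_extension iota delta (ext delta).
Hypothesis iota_linear : linear iota.
Variables (S : subalgebra (gl m)).

Lemma pi_ext delta p : pi (ext delta p) = delta (pi p).
Proof.
have [DD Di] := ext_ext delta.
rewrite -[X in ext _ X](subrK (iota (pi p))) linearD linearD /= Di iotaK.
have : p - iota (pi p) \in lower_central F 2.
  by rewrite -ker_pi memv_ker linearB /= iotaK subrr.
case/lie_prod_sum=> I [u [v [_ _ ->]]]; rewrite !linear_sum big1 ?add0r//.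
move=> i _; apply/eqP; rewrite -memv_ker ker_pi /= DD.
by rewrite rpredD// mem_lie_prod ?memvf.
Qed.

Lemma ext_linear : linear ext.
Proof.
move=> a g h; apply: (extension_unique (ext_ext _)); split.
  move=> x y; rewrite !add_lfunE !scale_lfunE.
  have [-> _] := ext_ext g; have [-> _] := ext_ext h.
  by rewrite scalerDr !lieDl !lieDr !lieZl !lieZr addrACA.
move=> x; rewrite !add_lfunE !scale_lfunE.
have [_ ->] := ext_ext g; have [_ ->] := ext_ext h.
by rewrite iota_linear.
Qed.

Lemma ext_bracket (g h : 'End(m)) :
  ext (gl_bracket g h) = ((ext g \o ext h) - (ext h \o ext g))%VF.
Proof.
have [gD gi] := ext_ext g; have [hD hi] := ext_ext h.
have iotaB x y : iota (x - y) = iota x - iota y.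
  by have := iota_linear (-1) y x; rewrite !scaleN1r addrC [- _ + _]addrC.
apply: (extension_unique (ext_ext _)); split => [x y|x].
  rewrite !add_lfunE !opp_lfunE !comp_lfunE hD gD !linearD /= !hD !gD.
  rewrite lieDl (lieC (- _)) !linearN /= -lieC !opprD !addrA.
  by rewrite [LHS](ACl (1*5*4*8*(2*7)*(3*6)))/= !subrr !addr0.
by rewrite !add_lfunE !opp_lfunE !comp_lfunE hi gi gi hi iotaB.
Qed.

(** [Phi^-1] is just a linear section; stability of the kernel makes the action independent of it.
    Faithfulness is visible on N / N^2, where S acts as it does on m. *)
Lemma quotient_admits_levi (N : lieAlgType k) (Phi : 'Hom(F, N)) :
  semisimple (sub_lie S) ->
  is_lie_hom Phi -> limg Phi = fullv -> (lker Phi <= lker pi)%VS ->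
  (forall delta, delta \in (S : {vspace gl m}) ->
    (ext delta @: lker Phi <= lker Phi)%VS) ->
  lie_type N = \dim {:m} /\ admits_faithful_levi S N.
Proof.
move=> ssS PhiL Phi_surj ker_Phi subm.
have PhiK : cancel Phi^-1%VF Phi.
  by move=> y; rewrite limg_lfunVK// Phi_surj memvf.
have surj y : exists p, y = Phi p by exists (Phi^-1%VF y); rewrite PhiK.
have kerPhi p : Phi^-1%VF (Phi p) - p \in lker Phi.
  by rewrite memv_ker linearB /= PhiK subrr.
pose phi := (pi \o Phi^-1)%VF.
have phiE p : phi (Phi p) = pi p.
  have /(subvP ker_Phi) := kerPhi p.
  by rewrite memv_ker linearB subr_eq0 comp_lfunE => /eqP.
have phi_surj : limg phi = fullv.
  apply/eqP; rewrite eqEsubv subvf; apply/subvP => x _.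
  by rewrite -[x]iotaK -phiE memv_img ?memvf.
have ker_phi : lker phi = lower_central N 2.
  rewrite -(limg_lower_central PhiL)// -ker_pi; apply/vspaceP => y.
  have [p ->] := surj y; rewrite memv_ker phiE -memv_ker.
  apply/idP/idP => [|/memv_imgP[q qk pq]]; first exact: memv_img.
  rewrite -(subrK q p) rpredD//; apply: (subvP ker_Phi).
  by rewrite memv_ker linearB /= pq subrr.
split.
  rewrite /lie_type -ker_phi -phi_surj -(limg_ker_dim phi fullv) capfv.
  by rewrite addnC addnK.
pose sg (s : sub_lie S) : gl N := (Phi \o ext (vsval s) \o Phi^-1)%VF.
have sgE s p : (sg s : 'End(N)) (Phi p) = Phi (ext (vsval s) p).
  rewrite !comp_lfunE; apply/eqP; rewrite -subr_eq0 -!linearB /= -memv_ker.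
  have /subvP sub := subm _ (subvsP s).
  by apply/sub/memv_img/kerPhi.
have sg_lin : linear sg.
  move=> a r s; apply/lfunP => y; have [p ->] := surj y.
  rewrite add_lfunE scale_lfunE !sgE.
  have -> : vsval (a *: r + s) = a *: vsval r + vsval s :> 'End(m).
    exact: linearP.
  by rewrite ext_linear add_lfunE scale_lfunE linearP.
pose sgL : {linear sub_lie S -> gl N} := HB.pack sg
  (GRing.isLinear.Build k _ _ _ _ sg_lin).
exists (linfun sgL); split; [split | |].
- exact: ssS.
- by apply: nilpotent_solvable (_ : lower_central N t.+1 = _);
    rewrite -(limg_lower_central PhiL)// nilF limg0.
- move=> r s; rewrite !(lfunE sgL) /=; apply/lfunP => y; have [p ->] := surj y.
  rewrite [LHS]sgE [lie (sg r) (sg s)]/(gl_bracket _ _) add_lfunE opp_lfunE.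
  rewrite (comp_lfunE (sg r)) (comp_lfunE (sg s)) !sgE.
  have -> : vsval (lie r s) = gl_bracket (vsval r) (vsval s) :=
    vsval_bracket r s.
  by rewrite ext_bracket add_lfunE opp_lfunE !comp_lfunE linearB.
- move=> s x y; have [p ->] := surj x; have [q ->] := surj y.
  rewrite !(lfunE sgL) /= -PhiL !sgE; have [-> _] := ext_ext (vsval s).
  by rewrite linearD /= !PhiL.
- apply/eqP; rewrite -subv0; apply/subvP => s;
  rewrite memv_ker (lfunE sgL) /= => /eqP s0.
  rewrite memv0; apply/eqP/val_inj/lfunP => x /=.
  have [_ si] := ext_ext (vsval s); rewrite -[LHS]iotaK -si -phiE -sgE s0.
  by rewrite !zero_lfunE linear0.
exists phi; split=> // s x; have [p ->] := surj x.
by rewrite (lfunE sgL) /= sgE !phiE pi_ext.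
Qed.

End Extensions.

Lemma levi_presentation (S : subalgebra (gl m)) (N : lieAlgType k) :
  [pchar k] =i pred0 -> semisimple (sub_lie S) ->
  (forall s : 'Hom(m, N), exists2 Phi : 'Hom(F, N),
    is_lie_hom Phi & forall x, Phi (iota x) = s x) ->
  lower_central N t.+1 = 0%VS -> admits_faithful_levi S N ->
  exists Phi : 'Hom(F, N),
    [/\ is_lie_hom Phi, limg Phi = fullv, (lker Phi <= lker pi)%VS
      & is_submodule S iota (lker Phi)].
Proof.
move=> k0 ssS univ nilN [sg [[_ _ sgL sgD] _ [phi [ker_phi phi_surj phi_eq]]]].
have [||||||s [sK s_eq]] := semisimple_equivariant_section k0 ssS
  (sigma := fun r => sg r : 'End(N)) (delta := fun r => vsval r : 'End(m))
    (phi := phi).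
- by move=> a x y; rewrite linearP.
- by move=> a x y; rewrite linearP.
- by move=> x y; rewrite sgL.
- by move=> x y; rewrite vsval_bracket.
- exact: phi_surj.
- exact: phi_eq.
have [Phi PhiL Phi_i] := univ s.
exists Phi; split=> //.
- apply: nilpotent_generation nilN (limg_subalgebra PhiL) _.
  apply/eqP; rewrite eqEsubv subvf; apply/subvP => y _.
  rewrite -(subrK (s (phi y)) y) addrC memv_add//.
    by rewrite -Phi_i memv_img ?memvf.
  by rewrite -ker_phi memv_ker linearB /= sK subrr.
- apply/subvP => p; rewrite !memv_ker => /eqP Phip.
  have := congr1 phi Phip.
  rewrite -{1}(subrK (iota (pi p)) p) linearD /= Phi_i linearD /= sK linear0.
  suff -> : phi (Phi (p - iota (pi p))) = 0 by rewrite add0r => ->.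
  apply/eqP; rewrite -memv_ker ker_phi.
  apply: (subvP (limg_lower_central_sub PhiL 1)); apply: memv_img.
  by rewrite -ker_pi memv_ker linearB /= iotaK subrr.
move=> delta D Sd [DD Di]; apply/subvP => _ /memv_imgP[p pk ->].
have dE : vsval (vsproj S delta) = delta by apply: vsprojK.
have inter := derivation_intertwine PhiL DD (sgD (vsproj S delta)).
move: pk; rewrite !memv_ker => /eqP pk.
rewrite inter ?pk ?linear0// => x.
by rewrite Di !Phi_i s_eq /= dE.
Qed.

End GeneratedLie.

(** * The free nilpotent models *)

Section ExteriorModels.

Variables (k : fieldType) (m : vectType k).
Hypothesis k0 : [pchar k] =i pred0.

Lemma natr_neq0_char0 i : i.+1%:R != 0 :> k.
Proof. by rewrite ((@pcharf0P k).1 k0). Qed.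

Lemma wedge_span (W : {vspace subvs_of (ext2 m)}) :
  (forall x y, wedge x y \in W) -> forall a, a \in W.
Proof.
move=> wW a.
rewrite -[a]vsvalK -(lfunE (vsproj (ext2 m))) memv_preim.
apply: (subvP _ _ (subvsP a)); apply/ext2P => x y.
by rewrite -memv_preim lfunE /= -vsval_wedge vsvalK.
Qed.

Definition tri_s (x : m) (a : subvs_of (ext2 m)) : subvs_of (s_space m) :=
  vsproj (s_space m) (tri x a).

Lemma vsval_tri_s (x : m) a : vsval (tri_s x a) = tri x a.
Proof. by rewrite vsprojK ?mem_tri. Qed.

(** As 3 is invertible, s is spanned by the brackets of m with the exterior square. *)
Lemma s_gen_tri (x y z : m) : s_gen x y z = 3%:R *: tri x (wedge y z).
Proof.
rewrite tri_wedge !scalerDr !scalerA mulfV ?natr_neq0_char0// !scale1r.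
by rewrite mulrCA mulfV ?natr_neq0_char0// mulr1.
Qed.

Lemma tri_s_span (W : {vspace subvs_of (s_space m)}) :
  (forall x y z, tri_s x (wedge y z) \in W) -> forall a, a \in W.
Proof.
move=> tW a.
rewrite -[a]vsvalK -(lfunE (vsproj (s_space m))) memv_preim.
apply: (subvP _ _ (subvsP a)); apply/s_spaceP => x y z.
by rewrite -memv_preim lfunE s_gen_tri linearZ rpredZ//; exact: tW.
Qed.

Lemma lie_jacobi3 (N : lieAlgType k) (x y z : N) :
  lie x (lie y z) = lie y (lie x z) + lie z (lie y x).
Proof.
rewrite lie_jacobi_der addrC; congr (_ + _).
by rewrite lieC (lieC y x) linearN.
Qed.

Section Universal.

Variables (N : lieAlgType k) (s : 'Hom(m, N)).

Lemma ext2_lift : exists B : 'Hom(subvs_of (ext2 m), N),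
  (forall x y, B (wedge x y) = lie (s x) (s y)) /\
  (forall a, B a \in lower_central N 2).
Proof.
have [||g [gE _]] := @tensor_univ _ m m N (fun x y => lie (s x) (s y)).
- by move=> y a u v; rewrite linearP lieDl lieZl.
- by move=> x a u v; rewrite linearP lieDr lieZr.
(* A wedge is x (x) y - y (x) x, without a factor 1/2, so the lift of the bracket to tensors doubles
   it. *)
exists (2%:R^-1 *: (g \o linfun vsval))%VF.
have BE x y : (2%:R^-1 *: (g \o linfun vsval))%VF (wedge x y) = lie (s x) (s y).
  rewrite scale_lfunE comp_lfunE lfunE /= vsval_wedge /alt linearB /= !gE.
  rewrite (lieC (s y)) opprK -mulr2n -scaler_nat scalerA mulVf ?scale1r//.
  exact: natr_neq0_char0.
split=> // a; rewrite memv_preim.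
by apply: wedge_span => x y; rewrite -memv_preim BE mem_lie_prod ?memvf.
Qed.

Lemma tri_s_linear (x : m) : linear (tri_s x).
Proof. by move=> a u v; rewrite /tri_s tri_linearr linearP. Qed.

HB.instance Definition _ (x : m) := GRing.isLinear.Build k (subvs_of (ext2 m))
  (subvs_of (s_space m)) _ (tri_s x) (tri_s_linear x).

(** [C] restricts to s the lift of the bracket to m (x) /\^2 m. On [tri x (wedge y z)] the
    coefficients 2/3, 1/3, 1/3 give [x, [y, z]], because the last two terms sum to 1/3 of it by
    [lie_jacobi3]. *)
Lemma s_lift (B : 'Hom(subvs_of (ext2 m), N)) :
  (forall x y, B (wedge x y) = lie (s x) (s y)) ->
  exists C : 'Hom(subvs_of (s_space m), N),
  (forall x a, C (tri_s x a) = lie (s x) (B a)) /\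
  (forall a, C a \in lower_central N 3).
Proof.
move=> BE.
have [||g [gE _]] := @tensor_univ _ m (subvs_of (ext2 m)) N
  (fun x a => lie (s x) (B a)).
- by move=> y a u v; rewrite linearP lieDl lieZl.
- by move=> x a u v; rewrite linearP lieDr lieZr.
pose C : 'Hom(subvs_of (s_space m), N) := (g \o linfun vsval)%VF.
have CE1 x y z : C (tri_s x (wedge y z)) = lie (s x) (lie (s y) (s z)).
  rewrite comp_lfunE lfunE /= vsval_tri_s tri_wedge !linearD !linearZ
    /= !gE !BE.
  have E3 : 2%:R / 3%:R + 3%:R^-1 = 1 :> k.
    rewrite -[X in _ + X]mul1r -mulrDl -(natrD _ 2 1) divff//.
    exact: natr_neq0_char0.
  by rewrite -addrA -scalerDr -lie_jacobi3 -scalerDl E3 scale1r.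
have CE x a : C (tri_s x a) = lie (s x) (B a).
  pose h := ((C \o linfun (tri_s x)) - (linfun (lie (s x)) \o B))%VF.
  have hE b : h b = C (tri_s x b) - lie (s x) (B b).
    by rewrite add_lfunE opp_lfunE !comp_lfunE !lfunE.
  have : a \in lker h.
    by apply: wedge_span => y z; rewrite memv_ker hE CE1 BE subrr.
  by rewrite memv_ker hE subr_eq0 => /eqP.
exists C; split=> // a; rewrite memv_preim; apply: tri_s_span => x y z.
by rewrite -memv_preim CE BE !mem_lie_prod ?memvf.
Qed.

End Universal.

Definition ext_N2 (delta : 'End(m)) : 'End(N2 m) :=
  linfun (fun p : N2 m => (delta p.1, ext2_act delta p.2) : N2 m).

Lemma ext_N2E delta p : ext_N2 delta p = (delta p.1, ext2_act delta p.2).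
Proof.
have lin : linear (fun p : N2 m => (delta p.1, ext2_act delta p.2) : N2 m).
  by move=> a u v; congr (_, _); rewrite /= linearP.
pose E : {linear N2 m -> N2 m} :=
  HB.pack (fun p : N2 m => (delta p.1, ext2_act delta p.2) : N2 m)
  (GRing.isLinear.Build k _ _ _ _ lin).
by rewrite /ext_N2 (lfunE E).
Qed.

Lemma N2_lieE (p q : N2 m) : lie p q = (0, wedge p.1 q.1).
Proof. by []. Qed.

Lemma ext_N2_extension delta : is_extension (@N2_gen k m) delta (ext_N2 delta).
Proof.
split=> [p q|x].
  rewrite !N2_lieE !ext_N2E /= linear0 ext2_actE.
  by congr (_, _); rewrite /= addr0.
by rewrite ext_N2E /= linear0.
Qed.

Definition pi_N2 : 'Hom(N2 m, m) :=
  linfun (fst : m * subvs_of (ext2 m) -> m).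

Lemma N2_genK : cancel (@N2_gen k m) pi_N2.
Proof. by move=> x; rewrite lfunE. Qed.

Lemma N2_gen_linear : linear (@N2_gen k m).
Proof. by move=> a u v; congr (_, _); rewrite /= scaler0 addr0. Qed.

Lemma N2_lower_central2 : lower_central (N2 m) 2 = N2_ext2 m.
Proof.
apply/eqP; rewrite eqEsubv; apply/andP; split.
  by apply/lie_prodP => p q _ _; rewrite mem_N2_ext2.
apply/subvP => -[x a]; rewrite mem_N2_ext2 /= => /eqP->.
have lin : linear (fun a => (0, a) : N2 m).
  by move=> c u v; congr (_, _); rewrite /= scaler0 addr0.
pose E : {linear subvs_of (ext2 m) -> N2 m} := HB.pack (fun a => (0, a) : N2 m)
  (GRing.isLinear.Build k _ _ _ _ lin).
rewrite -[(0, a)]/(E a) -(lfunE E) memv_preim; apply: wedge_span => y z.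
rewrite -memv_preim lfunE /=.
by rewrite -[(0, _)]/(lie (N2_gen y) (N2_gen z)) mem_lie_prod ?memvf.
Qed.

Lemma N2_lower_central3 : lower_central (N2 m) 3 = 0%VS.
Proof.
apply/eqP; rewrite -subv0 lower_centralS N2_lower_central2.
apply/lie_prodP => p q _; rewrite mem_N2_ext2 memv0 N2_lieE => /eqP->.
by rewrite linear0.
Qed.

Lemma N2_universal (N : lieAlgType k) (s : 'Hom(m, N)) :
  lower_central N 3 = 0%VS ->
  exists2 Phi : 'Hom(N2 m, N), is_lie_hom Phi & forall x, Phi (N2_gen x) = s x.
Proof.
move=> N3; have [B [BE BN]] := ext2_lift s.
have lin : linear (fun p : N2 m => s p.1 + B p.2).
  by move=> a u v; rewrite /= !linearP /= scalerDr addrACA.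
pose E : {linear N2 m -> N} := HB.pack (fun p : N2 m => s p.1 + B p.2)
  (GRing.isLinear.Build k _ _ _ _ lin).
have PhiE p : linfun E p = s p.1 + B p.2 by rewrite lfunE.
exists (linfun E) => [p q|x]; last by rewrite PhiE linear0 addr0.
have cB x a : lie x (B a) = 0.
  by apply/eqP; rewrite -memv0 -N3 lower_centralS mem_lie_prod ?memvf.
rewrite N2_lieE !PhiE linear0 add0r BE lieDr !lieDl !cB (lieC (B _)) cB.
by rewrite oppr0 !addr0.
Qed.

End ExteriorModels.

(** Matches the zero product of two elements of the exterior square in [N3]: their images in an
    algebra with N^4 = 0 also commute. *)
Lemma lie_lower_central2 (k : fieldType) (N : lieAlgType k) (x y : N) :
  x \in lower_central N 2 -> y \in lower_central N 2 ->
  lie x y \in lower_central N 4.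
Proof.
case/lie_prod_sum=> I [u [v [_ _ ->]]] Ny; rewrite lieC linear_sum rpredN /=.
apply: memv_suml => i _; rewrite lieC rpredN.
have -> : lie (lie (u i) (v i)) y =
  lie (u i) (lie (v i) y) - lie (v i) (lie (u i) y).
  by rewrite lie_jacobi_der addrK.
by rewrite rpredB// !mem_lie_prod ?memvf.
Qed.

Section FreeThreeNilpotent.

Variables (k : fieldType) (m : vectType k).
Hypothesis k0 : [pchar k] =i pred0.
Implicit Types (delta : 'End(m)) (x y z : m).

Lemma tens_act_tri_wedge delta x y z :
  tens_act delta (ext2_act delta) (tri x (wedge y z)) =
  tri (delta x) (wedge y z) + tri x (wedge (delta y) z) +
    tri x (wedge y (delta z)).
Proof.
rewrite !tri_wedge !linearD !linearZ /= !tens_actE !ext2_actE !linearD /=.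
by rewrite !addrA [LHS](ACl (1*5*9*2*4*8*3*6*7)).
Qed.

Lemma tens_act_tri delta x a :
  tens_act delta (ext2_act delta) (tri x a) =
  tri (delta x) a + tri x (ext2_act delta a).
Proof.
pose h := ((tens_act delta (ext2_act delta) \o linfun (tri x)) -
  (linfun (tri (delta x)) + (linfun (tri x) \o ext2_act delta)))%VF.
have hE b : h b = tens_act delta (ext2_act delta) (tri x b) -
    (tri (delta x) b + tri x (ext2_act delta b)).
  by rewrite !(add_lfunE, opp_lfunE) !comp_lfunE ![linfun _ _]lfunE.
have : a \in lker h.
  apply: wedge_span => y z; rewrite memv_ker hE tens_act_tri_wedge ext2_actE.
  by rewrite [tri x (_ + _)]linearD addrA subrr.
by rewrite memv_ker hE subr_eq0 => /eqP.
Qed.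

Lemma tens_act_s_space delta :
  (tens_act delta (ext2_act delta) @: s_space m <= s_space m)%VS.
Proof.
apply/subvP => _ /memv_imgP[t ts ->]; rewrite memv_preim.
apply: (subvP _ t ts); apply/s_spaceP => x y z; rewrite -memv_preim.
by rewrite s_gen_tri// linearZ rpredZ//= tens_act_tri rpredD ?mem_tri.
Qed.

Definition s_act delta (a : subvs_of (s_space m)) : subvs_of (s_space m) :=
  vsproj (s_space m) (tens_act delta (ext2_act delta) (vsval a)).

Lemma vsval_s_act delta a :
  vsval (s_act delta a) = tens_act delta (ext2_act delta) (vsval a).
Proof.
by rewrite vsprojK// (subvP (tens_act_s_space delta))// memv_img// subvsP.
Qed.

Lemma s_act_trip delta x a :
  s_act delta (tri_s x a) = tri_s (delta x) a + tri_s x (ext2_act delta a).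
Proof. by apply/val_inj; rewrite /= vsval_s_act !vsval_tri_s tens_act_tri. Qed.

Lemma s_act_linear delta : linear (s_act delta).
Proof. by move=> a u v; rewrite /s_act !linearP. Qed.

HB.instance Definition _ delta := GRing.isLinear.Build k (subvs_of (s_space m))
  (subvs_of (s_space m)) _ (s_act delta) (s_act_linear delta).

Lemma N3_lieE (p q : N3 m) :
  lie p q = (0, wedge p.1.1 q.1.1, tri_s p.1.1 q.1.2 - tri_s q.1.1 p.1.2).
Proof. by congr (_, _, _); rewrite /= linearB. Qed.

Definition ext_N3_fun delta (p : N3 m) : N3 m :=
  (delta p.1.1, ext2_act delta p.1.2, s_act delta p.2).

Lemma ext_N3_fun_linear delta : linear (ext_N3_fun delta).
Proof. by move=> a u v; congr (_, _, _); rewrite /= linearP. Qed.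

HB.instance Definition _ delta := GRing.isLinear.Build k (N3 m) (N3 m) _
  (ext_N3_fun delta) (ext_N3_fun_linear delta).

Definition ext_N3 delta : 'End(N3 m) := linfun (ext_N3_fun delta).

Lemma ext_N3E delta p :
  ext_N3 delta p = (delta p.1.1, ext2_act delta p.1.2, s_act delta p.2).
Proof. by rewrite lfunE. Qed.

Lemma ext_N3_extension delta : is_extension (@N3_gen k m) delta (ext_N3 delta).
Proof.
split=> [p q|x]; last by rewrite ext_N3E /= !linear0.
rewrite !N3_lieE !ext_N3E /= linear0 ext2_actE linearB /= !s_act_trip.
congr (_, _, _); rewrite /= ?addr0// opprD !addrA.
by rewrite [LHS](ACl (1*4*2*3)).
Qed.

Definition pi_N3 : 'Hom(N3 m, m) :=
  linfun ((fst : m * _ -> _) \o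
    (fst : m * subvs_of (ext2 m) * subvs_of (s_space m) -> _)).

Lemma N3_genK : cancel (@N3_gen k m) pi_N3.
Proof. by move=> x; rewrite lfunE. Qed.

Definition N3_inj2 (a : subvs_of (ext2 m)) : N3 m := (0, a, 0).
Definition N3_inj3 (t : subvs_of (s_space m)) : N3 m := (0, 0, t).

Lemma N3_inj2_linear : linear N3_inj2.
Proof. by move=> a u v; congr (_, _, _); rewrite /= scaler0 addr0. Qed.

Lemma N3_inj3_linear : linear N3_inj3.
Proof. by move=> a u v; congr (_, _, _); rewrite /= scaler0 addr0. Qed.

HB.instance Definition _ := GRing.isLinear.Build k (subvs_of (ext2 m)) (N3 m) _
  N3_inj2 N3_inj2_linear.
HB.instance Definition _ := GRing.isLinear.Build k
  (subvs_of (s_space m)) (N3 m) _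
  N3_inj3 N3_inj3_linear.

Lemma tri_s0l a : tri_s (0 : m) a = 0.
Proof. by rewrite /tri_s tri0l linear0. Qed.

Lemma wedge0r x : wedge x 0 = 0.
Proof. exact: linear0. Qed.

Lemma tri_s0r x : tri_s x 0 = 0.
Proof. exact: linear0. Qed.

Lemma N3_inj2_lower_central a : N3_inj2 a \in lower_central (N3 m) 2.
Proof.
rewrite -(lfunE N3_inj2) memv_preim; apply: wedge_span => x y.
rewrite -memv_preim lfunE /=.
have -> : N3_inj2 (wedge x y) = lie (N3_gen x) (N3_gen y).
  by rewrite N3_lieE /= !tri_s0r subrr.
by rewrite mem_lie_prod ?memvf.
Qed.

Lemma N3_inj3_lower_central t : N3_inj3 t \in lower_central (N3 m) 3.
Proof.
rewrite -(lfunE N3_inj3) memv_preim; apply: tri_s_span => // x y z.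
rewrite -memv_preim lfunE /=.
have -> : N3_inj3 (tri_s x (wedge y z)) = lie (N3_gen x) (N3_inj2 (wedge y z)).
  by rewrite N3_lieE /= wedge0r tri_s0l subr0.
by rewrite mem_lie_prod ?memvf// N3_inj2_lower_central.
Qed.

Lemma N3_lower_central2 : lower_central (N3 m) 2 = N3_ext2s m.
Proof.
apply/eqP; rewrite eqEsubv; apply/andP; split.
  by apply/lie_prodP => p q _ _; rewrite mem_N3_ext2s.
apply/subvP => -[[x a] t]; rewrite mem_N3_ext2s /= => /eqP->.
have -> : ((0, a, t) : N3 m) = N3_inj2 a + N3_inj3 t.
  by congr (_, _, _); rewrite /= ?addr0 ?add0r.
rewrite rpredD ?N3_inj2_lower_central//.
by apply: (subvP (lie_prod_subr _ (ideal_lower_central _ 1)));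
  exact: N3_inj3_lower_central.
Qed.

Lemma N3_lower_central3 : lower_central (N3 m) 3 = N3_s m.
Proof.
apply/eqP; rewrite eqEsubv; apply/andP; split.
  rewrite lower_centralS N3_lower_central2; apply/lie_prodP => p q _.
  rewrite mem_N3_ext2s mem_N3_s N3_lieE /= => /eqP->.
  by rewrite wedge0r !eqxx.
apply/subvP => -[[x a] t]; rewrite mem_N3_s /= => /andP[/eqP-> /eqP->].
exact: N3_inj3_lower_central.
Qed.

Lemma N3_lower_central4 : lower_central (N3 m) 4 = 0%VS.
Proof.
apply/eqP; rewrite -subv0 lower_centralS N3_lower_central3.
apply/lie_prodP => p q _; rewrite mem_N3_s memv0 N3_lieE =>
  /andP[/eqP-> /eqP->].
by rewrite wedge0r tri_s0l tri_s0r subrr.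
Qed.

Lemma N3_universal (N : lieAlgType k) (s : 'Hom(m, N)) :
  lower_central N 4 = 0%VS ->
  exists2 Phi : 'Hom(N3 m, N), is_lie_hom Phi & forall x, Phi (N3_gen x) = s x.
Proof.
move=> N4; have [B [BE BN]] := ext2_lift k0 s; have [C [CE CN]] := s_lift k0 BE.
have lin : linear (fun p : N3 m => s p.1.1 + B p.1.2 + C p.2).
  by move=> a u v; rewrite /= !linearP /= !scalerDr;
    rewrite !addrA [LHS](ACl (1*3*5*2*4*6)).
pose E : {linear N3 m -> N} := HB.pack (fun p : N3 m =>
  s p.1.1 + B p.1.2 + C p.2)
  (GRing.isLinear.Build k _ _ _ _ lin).
have PhiE p : linfun E p = s p.1.1 + B p.1.2 + C p.2 by rewrite lfunE.
exists (linfun E) => [p q|x]; last by rewrite PhiE !linear0 !addr0.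
have rC u c : lie u (C c) = 0.
  by apply/eqP; rewrite -memv0 -N4 lower_centralS mem_lie_prod ?memvf.
have lC u c : lie (C c) u = 0 by rewrite lieC rC oppr0.
have BB a b : lie (B a) (B b) = 0.
  by apply/eqP; rewrite -memv0 -N4 lie_lower_central2.
rewrite N3_lieE !PhiE /= linear0 add0r BE linearB /= !CE.
rewrite !lieDr !lieDl !rC !lC BB !addr0 (lieC (B _)).
by rewrite -[RHS]addrA [- _ + _]addrC.
Qed.

End FreeThreeNilpotent.

Lemma ideal_lker (k : fieldType) (L1 L2 : lieAlgType k) (f : 'Hom(L1, L2)) :
  is_lie_hom f -> is_ideal (lker f).
Proof.
move=> fL; apply/is_idealP => x y; rewrite !memv_ker fL => /eqP->.
by rewrite linear0.
Qed.

Theorem theorem4p1 (k : fieldType) (k_char0 : [pchar k] =i pred0)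
    (m : vectType k) (d : nat) (dim_m : \dim {:m} = d)
    (S : subalgebra (gl m)) (S_sl : (S <= sl m)%VS)
    (S_ss : semisimple (sub_lie S)) :
  [/\ (* extended module structure *)
      forall delta : 'End(m), delta \in (S : {vspace gl m}) ->
        [/\ (tens_act delta delta @: ext2 m <= ext2 m)%VS,
            (tens_act delta (ext2_act delta) @: s_space m <= s_space m)%VS,
            exists D : 'End(N2 m),
              unique (is_extension (@N2_gen k m) delta) D /\
              (forall p : N2 m, (D p).1 = delta p.1 /\
                 vsval (D p).2 = tens_act delta delta (vsval p.2))
          & exists D : 'End(N3 m),
              unique (is_extension (@N3_gen k m) delta) D /\
              (forall p : N3 m, [/\ (D p).1.1 = delta p.1.1,
                 vsval (D p).1.2 = tens_act delta delta (vsval p.1.2)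
                 & vsval (D p).2 =
                     tens_act delta (ext2_act delta) (vsval p.2)])],
      (* (a) *)
      forall N : lieAlgType k,
        [/\ nilpotent N 2, lie_type N = d & admits_faithful_levi S N] <->
        exists I : ideal (N2 m),
          [/\ (I <= N2_ext2 m)%VS, (I : {vspace N2 m}) <> N2_ext2 m,
              is_submodule S (@N2_gen k m) I
            & lie_isomorphic N (quot_lie I)]
    & (* (b) *)
      forall N : lieAlgType k,
        [/\ nilpotent N 3, lie_type N = d & admits_faithful_levi S N] <->
        exists (J : {vspace N3 m}) (K : ideal (N3 m)),
          [/\ (J <= N3_ext2s m)%VS, is_submodule S (@N3_gen k m) J,
              (K : {vspace N3 m}) = (J + lie_prod J (N3_m m))%VS,
              ~~ (N3_s m <= J + lie_prod J (N3_m m))%VS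
            & lie_isomorphic N (quot_lie K)]].
Proof.
have ker2 : lker (pi_N2 m) = lower_central (N2 m) 2
  by rewrite N2_lower_central2.
have ker3 : lker (pi_N3 m) = lower_central (N3 m) 2.
  by rewrite N3_lower_central2.
have nil2 := N2_lower_central3 m.
have nil3 := N3_lower_central4 m k_char0.
have ext2P delta := ext_N2_extension (m := m) delta.
have ext3P delta := ext_N3_extension k_char0 (m := m) delta.
split.
- move=> delta _; split.
  + exact: tens_act_ext2.
  + exact: tens_act_s_space.
  + exists (ext_N2 delta); split; last first.
      by move=> p; rewrite ext_N2E /= vsval_ext2_act.
    split=> // D' DP.
    exact: (extension_unique (@N2_genK _ _) ker2 nil2 (ext2P delta) DP).
  exists (ext_N3 delta); split; last first.
    by move=> p; rewrite ext_N3E /= vsval_ext2_act vsval_s_act.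
  split=> // D' DP.
  exact: (extension_unique (@N3_genK _ _) ker3 nil3 (ext3P delta) DP).
- move=> N; split=> [[[N2n0 N3] _ adm]|[I
  [I2 neI subI /lie_isomorphic_quotP[Phi [PhiL Phi_surj kerPhi]]]]].
    have [|Phi [PhiL Phi_surj kerPhi subPhi]] := levi_presentation
      (@N2_genK _ _) ker2 nil2 k_char0 S_ss _ N3 adm.
      by move=> s; exact: N2_universal.
    exists (Ideal (ideal_lker PhiL)); split=> //=.
      move=> kerE; case/negP: N2n0.
      by rewrite -(limg_lower_central PhiL)// N2_lower_central2 -kerE -lkerE.
    by apply/lie_isomorphic_quotP; exists Phi.
  have kerLC : (lker Phi <= lower_central (N2 m) 2)%VS.
    by rewrite kerPhi N2_lower_central2.
  have [typeN adm] : lie_type N = \dim {:m} /\ admits_faithful_levi S N.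
    apply: (quotient_admits_levi (@N2_genK _ _) ker2 nil2 ext2P
      (@N2_gen_linear _ _) S_ss
      PhiL Phi_surj); first by rewrite ker2.
    by move=> delta Sd; rewrite kerPhi; apply: (subI delta _ Sd (ext2P delta)).
  split=> //; last by rewrite typeN.
  split; last by rewrite -(limg_lower_central PhiL)// nil2 limg0.
  rewrite -(limg_lower_central PhiL)// N2_lower_central2 -lkerE kerPhi.
  by apply/negP => I2'; apply: neI; apply/eqP; rewrite eqEsubv I2.
move=> N; split=> [[[N3n0 N4] _ adm]|
    [J [K [J2 subJ KE s'K /lie_isomorphic_quotP[Phi [PhiL Phi_surj kerPhi]]]]]].
  have [|Phi [PhiL Phi_surj kerPhi subPhi]] := levi_presentation
    (@N3_genK _ _) ker3 nil3 k_char0 S_ss _ N4 adm.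
    by move=> s; exact: N3_universal.
  (* The kernel itself serves as [J]: being an ideal, it already contains its brackets with m. *)
  have JE : (lker Phi + lie_prod (lker Phi) (N3_m m))%VS = lker Phi.
    apply/eqP; rewrite eqEsubv addvSl subv_add subvv/= andbT.
    apply/lie_prodP => p q pk _; rewrite lieC rpredN.
    exact: (is_idealP _ (ideal_lker PhiL)).
  exists (lker Phi), (Ideal (ideal_lker PhiL)); split=> //=.
  - apply: contra N3n0; rewrite JE -N3_lower_central3// lkerE.
    by rewrite (limg_lower_central PhiL).
  by apply/lie_isomorphic_quotP; exists Phi.
(* Only [J] is assumed stable; [J, m] is stable too, because the extension is a derivation that
   preserves the copy of m. *)
have subK delta : delta \in (S : {vspace gl m}) -> (ext_N3 delta @: K <= K)%VS.
  move=> Sd; have [DD Di] := ext3P delta.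
  have /subvP DJ := subJ delta _ Sd (ext3P delta).
  rewrite KE limgD subv_add (subv_trans _ (addvSl _ _)) ?subvf//=;
    last exact/subvP.
  apply/subvP => _ /memv_imgP[x /lie_prod_sum[I0 [u [v [uJ vm ->]]]] ->].
  rewrite linear_sum memv_suml// => i _ /=; rewrite DD.
  have /memv_imgP[y _ vE] := vm i.
  have Dv : ext_N3 delta (v i) \in N3_m m.
    have {}vE : v i = N3_gen y by rewrite vE lfunE.
    by rewrite vE Di -(lfunE (@N3_gen k m)) memv_img ?memvf.
  apply: (subvP (addvSr _ _)).
  by rewrite rpredD// mem_lie_prod// DJ// memv_img.
have kerLC : (lker Phi <= lower_central (N3 m) 2)%VS.
  rewrite kerPhi KE subv_add {1}(N3_lower_central2 m k_char0) J2/=.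
  by apply: lie_prodS; exact: subvf.
have [typeN adm] : lie_type N = \dim {:m} /\ admits_faithful_levi S N.
  apply: (quotient_admits_levi (@N3_genK _ _) ker3 nil3 ext3P
    (@N3_gen_linear _ _) S_ss
    PhiL Phi_surj); first by rewrite ker3.
  by rewrite kerPhi.
split=> //; last by rewrite typeN.
split; last by rewrite -(limg_lower_central PhiL)// nil3 limg0.
by rewrite -(limg_lower_central PhiL)// N3_lower_central3// -lkerE kerPhi KE.
Qed.
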